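(* Let $G=\mathbb{R}^{2n+m}$ be an H-type group. The Carnot–Carathéodory distance from the identity $0$ to a point $(x,z)\in G$ is $$d_0(x,z)=d(0,(x,z))=\begin{cases}|x|\,\dfrac{\theta}{\sin\theta}, & z\ne0,\ x\ne0,\\[1ex] |x|, & z=0,\\[0.5ex] \sqrt{4\pi|z|}, & x=0,\end{cases}$$ where, in the first case, $\theta$ is the unique solution in $[0,\pi)$ of $\nu(\theta)=\dfrac{4|z|}{|x|^2}$, with $\nu(\theta)=\dfrac{2\theta-\sin2\theta}{1-\cos2\theta}$ (and $\nu(0)=0$ by continuity).
   Context: H-type groups. A finite-dimensional real Lie algebra $\mathfrak g$ with center $\mathfrak z$ is an H-type Lie algebra under an inner product $\langle\cdot,\cdot\rangle$ if $[\mathfrak z^\perp,\mathfrak z^\perp]=\mathfrak z$ and, for each $z\in\mathfrak z$ with $|z|=1$, the map $J_z:\mathfrak z^\perp\to\mathfrak z^\perp$ defined by $\langle J_z x,y\rangle=\langle z,[x,y]\rangle$ is orthogonal. An H-type group is a connected, simply connected Lie group whose Lie algebra is H-type. Every such group is realized as $G=\mathbb{R}^{2n+m}$ ($n,m\ge1$), with elements $g=(x,z)$, $x\in\mathbb{R}^{2n}$, $z\in\mathbb{R}^m$, where $(\mathbb{R}^{2n+m},[\cdot,\cdot])$ is an H-type Lie algebra under the Euclidean inner product with center $\{0\}\times\mathbb{R}^m$, the bracket is regarded as a map $\mathbb{R}^{2n}\times\mathbb{R}^{2n}\to\mathbb{R}^m$, and the group law is $(x,z)\star(x',z')=(x+x',\,z+z'+\frac12[x,x'])$,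 with identity $0$. Let $\{e_i\}$, $\{u_j\}$ be the standard bases of $\mathbb{R}^{2n}$, $\mathbb{R}^m$, and let $X_i=\frac{\partial}{\partial x_i}+\frac12\sum_{j=1}^m\langle J_{u_j}x,e_i\rangle\frac{\partial}{\partial z_j}$, $i=1,\dots,2n$ (the left-invariant vector fields with $X_i(0)=\partial_{x_i}$). Distance. An absolutely continuous path $\gamma:[0,1]\to G$ is horizontal if $\dot\gamma(t)\in\mathrm{span}\{X_i(\gamma(t))\}$ for a.e. $t$; writing $\dot\gamma=\sum_i a_iX_i(\gamma)$, its length is $\int_0^1(\sum_i a_i(t)^2)^{1/2}dt$. $d(g,h)$ is the infimum of lengths of horizontal paths from $g$ to $h$. *)

(* Defs.v *)
From HB Require Import structures.
From mathcomp Require Import all_boot all_order all_algebra.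
From mathcomp Require Import all_classical all_reals all_analysis.

Set Implicit Arguments.
Unset Strict Implicit.
Unset Printing Implicit Defensive.

Import Order.TTheory GRing.Theory Num.Theory.
Import numFieldNormedType.Exports.

Local Open Scope classical_set_scope.
Local Open Scope ring_scope.

(* The Euclidean inner product.  The norm carried by 'rV[R]_n in the library is
   the sup norm `|_|, which is used below only through the topology. *)
Section euclidean.
Variables (R : realType) (n : nat).
Implicit Types u v : 'rV[R]_n.

Definition edot u v : R := \sum_i u 0 i * v 0 i.

Let edot_bilinear : bilinear_for *%R (idfun \; *%R) edot.
Proof.
split=> w a u v /=; rewrite /edot mulr_sumr -big_split /=;
  by apply: eq_bigr => i _; rewrite !mxE ?mulrDl ?mulrDr ?mulrA // (mulrC a).
Qed.

HB.instance Definition _ := bilinear_isBilinear.Build R 'rV[R]_n 'rV[R]_n R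
  *%R (idfun \; *%R) edot edot_bilinear.

Let edot_sym u v : edot u v = (-1) ^+ false * idfun (edot v u).
Proof. by rewrite expr0 mul1r /edot; apply: eq_bigr => i _; rewrite mulrC. Qed.

HB.instance Definition _ :=
  isHermitianSesquilinear.Build R 'rV[R]_n false idfun edot edot_sym.

Let edot_gt0 u : u != 0 -> 0 < edot u u.
Proof.
have sq_ge0 (i : 'I_n) : true -> 0 <= u 0 i * u 0 i by rewrite -expr2 sqr_ge0.
move=> u0; rewrite lt_def sumr_ge0 // andbT.
apply: contra u0; rewrite psumr_eq0 // => /allP u0.
apply/eqP/rowP => i; rewrite mxE; apply/eqP.
by have := u0 i (mem_index_enum i); rewrite mulf_eq0 orbb.
Qed.

HB.instance Definition _ :=
  isDotProduct.Build R 'rV[R]_n edot edot_gt0.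

Definition enorm u : R := Num.sqrt (edot u u).

End euclidean.

Section htype_algebra.
Variables (R : realType) (g : vectType R).
Implicit Types (A : set g) (x y z : g).

Definition linear_span A : set g :=
  [set v | exists k (c : 'I_k -> R) (w : 'I_k -> g),
     (forall i, A (w i)) /\ v = \sum_i c i *: w i].

Variables (ip : {dot g for idfun}) (br : {bilinear g -> g -> g}).

Definition lie_bracket :=
  (forall x, br x x = 0) /\
  (forall x y z, br x (br y z) + br y (br z x) + br z (br x y) = 0).

Definition center : set g := [set z | forall x, br z x = 0].

Definition orth_compl A : set g := [set x | forall z, A z -> ip x z = 0].

Let V := orth_compl center.

(* J z x is the element w of the orthogonal complement V of the center such that
   <w, y> = <z, [x, y]> for all y in V; it exists and is unique because g is
   finite-dimensional, so that the default value 0 is never taken. *)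
Definition Jmap z x : g :=
  xget 0 [set w | V w /\ forall y, V y -> ip w y = ip z (br x y)].

(* Jmap z is automatically linear on V, so preserving the inner product is all
   that orthogonality requires. *)
Definition htype_algebra :=
  [/\ lie_bracket,
      linear_span [set v | exists x y, [/\ V x, V y & v = br x y]] = center &
      forall z, center z -> Num.sqrt (ip z z) = 1 ->
        forall x y, V x -> V y -> ip (Jmap z x) (Jmap z y) = ip x y].

End htype_algebra.

Section htype_group.
Variables (R : realType) (n m : nat).

Local Notation G := 'rV[R]_(2 * n + m).

Variable br : {bilinear G -> G -> G}.

(* The inner product of G restricts to the ones of R^2n and R^m, which are
   embedded in G as the row_mx x 0 and the row_mx 0 z. *)
Definition htype_group :=
  htype_algebra (@edot R (2 * n + m)) br /\
  center br = [set row_mx 0 z | z in [set: 'rV[R]_m]].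

Definition hpart (p : G) : G := row_mx (lsubmx p) 0.

Definition evec (i : 'I_(2 * n)) : G := row_mx (delta_mx 0 i) 0.

Definition uvec (j : 'I_m) : G := row_mx 0 (delta_mx 0 j).

Definition hmul (p q : G) : G := p + q + 2^-1 *: br (hpart p) (hpart q).

Definition Xfield (i : 'I_(2 * n)) (p : G) : G :=
  evec i + 2^-1 *:
    \sum_j edot (Jmap (@edot R (2 * n + m)) br (uvec j) (hpart p)) (evec i)
             *: uvec j.

Lemma edot_row_mx (x x' : 'rV[R]_(2 * n)) (z z' : 'rV[R]_m) :
  edot (row_mx x z) (row_mx x' z') = edot x x' + edot z z'.
Proof.
rewrite /edot big_split_ord /=; congr (_ + _); apply: eq_bigr => i _.
  by rewrite !row_mxEl.
by rewrite !row_mxEr.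
Qed.

Lemma edot0r k (u : 'rV[R]_k) : edot u 0 = 0.
Proof. by rewrite /edot big1 // => i _; rewrite mxE mulr0. Qed.

Lemma edot0l k (u : 'rV[R]_k) : edot 0 u = 0.
Proof. by rewrite /edot big1 // => i _; rewrite mxE mul0r. Qed.

Lemma edot_delta k (u : 'rV[R]_k) i : edot u (delta_mx 0 i) = u 0 i.
Proof.
rewrite /edot (bigD1 i) //= big1 => [|j ji]; rewrite !mxE ?eqxx ?mulr1 ?addr0 //.
by rewrite (negbTE ji) andbF mulr0.
Qed.

Lemma orth_compl_center (w : G) : center br = [set row_mx 0 z | z in setT] ->
  orth_compl (@edot R (2 * n + m)) (center br) w <-> rsubmx w = 0.
Proof.
move=> ->; split=> [h|h _ [z _ <-]]; last first.
  by rewrite -(hsubmxK w) h -[LHS]/(edot _ _) edot_row_mx edot0r edot0l addr0.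
apply/rowP => j; rewrite [RHS]mxE -edot_delta.
have : edot w (row_mx 0 (delta_mx 0 j)) = 0 by apply: h; exists (delta_mx 0 j).
by rewrite -{1}(hsubmxK w) edot_row_mx edot0r add0r.
Qed.

Lemma Jmap_hpart (z p q : G) : center br = [set row_mx 0 z | z in setT] ->
  rsubmx (Jmap (@edot R (2 * n + m)) br z (hpart p)) = 0 /\
  edot (Jmap (@edot R (2 * n + m)) br z (hpart p)) (hpart q) =
    edot z (br (hpart p) (hpart q)).
Proof.
move=> cE; rewrite /Jmap.
case: xgetP => [w _ [/(orth_compl_center _ cE) wV wJ]|].
  split=> //; apply: wJ; apply/orth_compl_center => //.
  by rewrite /hpart row_mxKr.
pose w : G := row_mx (\row_i edot z (br (hpart p) (evec i))) 0.
move=> /(_ w)[]; split; first by apply/orth_compl_center => //; rewrite row_mxKr.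
move=> y /(orth_compl_center _ cE) y0.
have -> : y = \sum_i y 0 (lshift m i) *: evec i.
  apply/rowP => k; rewrite summxE; case: (split_ordP k) => j ->.
    rewrite (bigD1 j) //= big1 => [|i ij]; rewrite mxE row_mxEl mxE.
      by rewrite !eqxx mulr1 addr0.
    by rewrite eq_sym (negbTE ij) andbF mulr0.
  rewrite big1 => [|i _]; last by rewrite mxE row_mxEr mxE mulr0.
  by have /rowP/(_ j) := y0; rewrite !mxE.
rewrite !linear_sumr /=; apply: eq_bigr => i _.
by rewrite !linearZr /= edot_row_mx edot0r addr0 edot_delta mxE.
Qed.

(* X_i is the left-invariant vector field that equals e_i at the identity. *)
Lemma hmul_Xfield (p : G) i : htype_group ->
  is_derive (0 : R) 1 (fun t : R => hmul p (t *: evec i)) (Xfield i p).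
Proof.
move=> [[[alt _] der _] cE].
have brC : forall u v, br u v = - br v u.
  move=> u v; apply/eqP; rewrite -addr_eq0; apply/eqP.
  by have := alt (u + v); rewrite linearDl !linearDr /= !alt add0r addr0.
have hE j : hpart (evec j) = evec j by rewrite /hpart row_mxKl.
have hZ (t : R) : hpart (t *: evec i) = t *: evec i.
  rewrite /hpart linearZ /= row_mxKl -[X in _ = _ *: X]/(row_mx _ _).
  by rewrite scale_row_mx scaler0.
have XE : Xfield i p = evec i + 2^-1 *: br (hpart p) (evec i).
  rewrite /Xfield; congr (_ + _ *: _).
  under eq_bigr => j _.
    rewrite -{1}(hE i) (Jmap_hpart _ _ _ cE).2 hE.
    over.
  have : center br (br (hpart p) (evec i)).
    rewrite -der; exists 1%N, (fun=> 1), (fun=> br (hpart p) (evec i)).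
    split=> [_|]; last by rewrite big_ord1 scale1r.
    exists (hpart p), (evec i); split=> //; apply/orth_compl_center => //;
      by rewrite row_mxKr.
  rewrite cE => -[z _ <-].
  apply/rowP => k; rewrite summxE; case: (split_ordP k) => j ->.
    by rewrite row_mxEl mxE big1 // => l _; rewrite mxE row_mxEl mxE mulr0.
  rewrite row_mxEr (bigD1 j) //= big1 => [|l lj].
    rewrite mxE row_mxEr mxE !eqxx mulr1 addr0 edot_row_mx edot0l add0r.
    rewrite /edot (bigD1 j) //= big1 => [|l lj].
      by rewrite !mxE !eqxx mul1r addr0.
    by rewrite !mxE (negbTE lj) andbF mul0r.
  by rewrite mxE row_mxEr mxE eq_sym (negbTE lj) andbF mulr0.
have -> : (fun t : R => hmul p (t *: evec i)) = (fun t : R => p + t *: Xfield i p).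
  apply/funext => t; rewrite /hmul hZ linearZr /= XE scalerDr addrA.
  by rewrite !scalerA [t * _]mulrC.
have cv : (fun h : R => h^-1 *: (((fun t : R => p + t *: Xfield i p) \o shift 0)
    (h *: 1) - (p + 0 *: Xfield i p))) @ 0^' --> Xfield i p.
  apply: cvg_near_cst; near=> h.
  rewrite /= addr0 scale0r addr0 addrAC subrr add0r scalerA.
  rewrite [h *: 1]mulr1 mulVf ?scale1r //.
  by near: h; exact: nbhs_dnbhs_neq.
by split; [apply/cvg_ex; exists (Xfield i p) | exact: cvg_lim cv].
Unshelve. all: by end_near. Qed.

Definition abs_continuous_on (a b : R) (f : R -> G) :=
  forall e : R, 0 < e -> exists2 d : R, 0 < d &
    forall k (s t : 'I_k -> R),
      (forall i, a <= s i /\ s i <= t i /\ t i <= b) ->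
      trivIset setT (fun i => `]s i, t i[%classic) ->
      \sum_i (t i - s i) < d -> \sum_i enorm (f (t i) - f (s i)) < e.

Definition horizontal (c : R -> G) :=
  abs_continuous_on 0 1 c /\
  {ae @lebesgue_measure R, forall t, `[0, 1]%classic t ->
     derivable c t 1 /\
     linear_span [set Xfield i (c t) | i in setT] (derive1 c t)}.

(* The X_i are linearly independent at every point, so these coordinates are
   determined by the derivative; the value 0 is taken at the t where it is not in
   their span, which for a horizontal path form a negligible set. *)
Definition hcoord (c : R -> G) (t : R) : 'rV[R]_(2 * n) :=
  xget 0 [set a : 'rV[R]_(2 * n) | derive1 c t = \sum_i a 0 i *: Xfield i (c t)].

Definition path_length (c : R -> G) : \bar R :=
  (\int[@lebesgue_measure R]_(t in `[0%R, 1%R]) (enorm (hcoord c t))%:E)%E.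

Definition cc_dist (p q : G) : \bar R :=
  ereal_inf [set path_length c | c in
    [set c : R -> G | [/\ horizontal c, c 0 = p & c 1 = q]]].

End htype_group.

Definition nu (R : realType) (theta : R) : R :=
  if theta == 0 then 0
  else (2 * theta - sin (2 * theta)) / (1 - cos (2 * theta)).

(* Main.v *)
(* Lower bound.  Let (x, z) be a horizontal curve of length at most l issued from 0, with
   speed |a| and arclength L.  The Hamilton-Jacobi equation
   w_s + |grad_H w|^2 / 2 = 0 has, for every unit central vector u, the solution
   w(x, z, s) = k <u, z> + y(s) |x|^2 with y(s) = (k / 4) cot (k s / 2): the horizontal
   gradient of w is (k / 2) J_u x + 2 y x, whose two terms are orthogonal because J_u is
   skew, so that the equation reduces to y' = - 2 y^2 - k^2 / 8.  Hence w - L / 2, with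
   s = e + L and e > 0 to avoid the singularity of cot, decreases along the curve.  With
   k (l + e) = 2 theta and e -> 0 this gives, for all theta in ]0, pi[,
     4 theta |z| + theta cot(theta) |x|^2 <= l^2.
   The best theta solves nu(theta) = 4 |z| / |x|^2, and the bound is then
   (|x| theta / sin theta)^2; it is used with theta -> 0 when z = 0 and theta -> pi when
   x = 0.
   Upper bound.  The bound is attained by the curves that project to circular arcs in the
   plane of v and J_u v, whose central part stays on the line of u since
   [v, J_u v] = |v|^2 u. *)

Require Import Defs.
From mathcomp Require Import all_boot all_order all_algebra.
From mathcomp Require Import all_classical all_reals all_analysis.
From mathcomp Require Import measurable_realfun ring lra.
Import Order.TTheory GRing.Theory Num.Theory.
Import numFieldNormedType.Exports.
Local Open Scope classical_set_scope.
Local Open Scope ring_scope.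
Set Implicit Arguments.
Unset Strict Implicit.
Unset Printing Implicit Defensive.

(** * Monotonicity of absolutely continuous functions *)

(** Real induction: let [s] be the supremum of the [t] with [P a t]. The local property at [s] joins
    a point of that set just below [s] to a point above it, which forces [s = b]. *)
Lemma cousin_additive (R : realType) (a b : R) (P : R -> R -> Prop) : a <= b ->
  (forall x y z, a <= x -> x <= y -> y <= z -> z <= b -> P x y -> P y z -> P x z) ->
  (forall t, a <= t -> t <= b -> exists2 d : R, 0 < d &
     forall x y, a <= x -> x <= t -> t <= y -> y <= b -> t - x < d -> y - t < d ->
     P x y) ->
  P a b.
Proof.
move=> ab Ptrans Ploc.
pose A := [set t | a <= t <= b /\ P a t].
have Aa : A a.
  have [d d0 Pd] := Ploc a (lexx a) ab.
  by split; rewrite ?lexx//; apply: Pd; rewrite ?lexx// subrr.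
have Ab : has_ubound A by exists b => t [/andP[]].
have hsA : has_sup A by split; [exists a|].
set s := sup A.
have as_ : a <= s by exact: ub_le_sup.
have sb : s <= b by apply: ge_sup; [exists a|move=> t [/andP[]]].
have [d d0 Pd] := Ploc s as_ sb.
have [t [/andP[at_ tb] Pat]] := sup_adherent d0 hsA; rewrite -/s => st.
have ts : t <= s by apply: ub_le_sup => //; split=> //; apply/andP.
pose y := Num.min b (s + d / 2).
have sy : s <= y by rewrite le_min sb lerDl divr_ge0// ltW.
have yb : y <= b by rewrite ge_min lexx.
have ysd : y <= s + d / 2 by rewrite ge_min lexx orbT.
have Pty : P t y by apply: Pd => //; lra.
have Ay : A y.
  split; first by rewrite yb andbT; lra.
  by apply: (Ptrans a t y) => //; lra.
have ys : y <= s by exact: ub_le_sup.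
suff -> : b = y by case: Ay.
by move: ys sy; rewrite /y; case: (leP b (s + d / 2)) => //; lra.
Qed.

Lemma trivIset_ordered_pairs (R : realType) (l : seq (R * R)) :
  pairwise (fun p q : R * R => p.2 <= q.1) l ->
  trivIset setT (fun i : 'I_(size l) =>
    `](tnth (in_tuple l) i).1, (tnth (in_tuple l) i).2[%classic).
Proof.
move=> /(pairwiseP (0, 0)) pl.
have disj (i j : 'I_(size l)) : (i < j)%N ->
    `](tnth (in_tuple l) i).1, (tnth (in_tuple l) i).2[%classic `&`
    `](tnth (in_tuple l) j).1, (tnth (in_tuple l) j).2[%classic = set0.
  move=> ij; have := pl i j (ltn_ord i) (ltn_ord j) ij.
  rewrite !(tnth_nth (0, 0)) /= => h.
  apply/seteqP; split=> // x []; rewrite /= !in_itv /= => /andP[_ x1] /andP[x2 _].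
  by have := lt_le_trans x1 h; rewrite ltNge (ltW x2).
apply/trivIsetP => i j _ _ ij.
have : val i != val j by [].
rewrite neq_ltn => /orP[|] ?; first exact: disj.
by rewrite setIC; exact: disj.
Qed.

Lemma sum_length_le_measure (R : realType) (l : seq (R * R)) (U : set R) :
  measurable U -> pairwise (fun p q : R * R => p.2 <= q.1) l ->
  (forall p, p \in l -> p.1 <= p.2 /\ `]p.1, p.2[%classic `<=` U) ->
  ((\sum_(p <- l) (p.2 - p.1))%:E <= @lebesgue_measure R U)%E.
Proof.
move=> mU pl lU.
have tl := trivIset_ordered_pairs pl.
pose F (i : 'I_(size l)) := `](tnth (in_tuple l) i).1, (tnth (in_tuple l) i).2[%classic.
have mF i : measurable (F i) by exact: measurable_itv.
have mUF : measurable (\big[setU/set0]_i F i) by exact: bigsetU_measurable.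
have -> : (\sum_(p <- l) (p.2 - p.1))%:E = lebesgue_measure (\big[setU/set0]_i F i).
  rewrite [RHS]measure_semi_additive_ord//.
  rewrite big_tnth -sumEFin; apply: eq_bigr => i _.
  have [le _] := lU _ (mem_tnth i (in_tuple l)).
  apply: etrans (esym (lebesgue_measure_itv _)); rewrite /= lte_fin.
  by case: ltgtP le => // ->; rewrite subrr.
have FU : \big[setU/set0]_i F i `<=` U.
  elim/big_ind: _ => [//|A B AU BU|i _]; first by rewrite subUset.
  by have [_] := lU _ (mem_tnth i (in_tuple l)).
by apply: le_measure => //; rewrite inE.
Qed.

(** Absolute continuity in a form suited to gluing: lists of successive intervals concatenate, and
    the measure of [U] bounds their total length. *)
Lemma abs_continuous_sum (R : realType) (n m : nat) (a b : R)
    (c : R -> 'rV[R]_(2 * n + m)) (e : R) :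
  abs_continuous_on a b c -> 0 < e ->
  exists2 d : R, 0 < d & forall (l : seq (R * R)) (U : set R), measurable U ->
    (@lebesgue_measure R U < d%:E)%E ->
    pairwise (fun p q : R * R => p.2 <= q.1) l ->
    (forall p, p \in l ->
      [/\ a <= p.1, p.1 <= p.2, p.2 <= b & `]p.1, p.2[%classic `<=` U]) ->
    \sum_(p <- l) enorm (c p.2 - c p.1) < e.
Proof.
move=> ac e0; have [d d0 acd] := ac e e0; exists d => // l U mU Ud pl lU.
have := acd (size l) (fun i => (tnth (in_tuple l) i).1)
  (fun i => (tnth (in_tuple l) i).2).
rewrite (big_tnth _ _ l) /=; apply.
- by move=> i; have [? ? ? _] := lU _ (mem_tnth i (in_tuple l)).
- exact: trivIset_ordered_pairs.
- rewrite -(big_tnth 0 +%R l xpredT (fun p : R * R => p.2 - p.1)).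
  rewrite -lte_fin; apply: le_lt_trans Ud; apply: sum_length_le_measure => //.
  by move=> p /lU[].
Qed.

(** The straddle inequality: since [x] and [y] lie on either side of [t], the increment splits at
    [t], and each half is controlled by a difference quotient at [t]. *)
Lemma derive1_le0_near (R : realType) (H : R -> R) (t e : R) :
  derivable H t 1 -> derive1 H t <= 0 -> 0 < e ->
  exists2 d : R, 0 < d & forall x y, x <= t -> t <= y -> t - x < d -> y - t < d ->
    H y - H x <= e * (y - x).
Proof.
move=> dH H0 e0.
have : h^-1 *: (H (h + t) - H t) @[h --> 0^'] --> derive1 H t.
  by rewrite derive1E; under eq_fun do rewrite -[X in H (X + t)]mulr1; exact: dH.
move=> /cvgrPdist_lt /(_ _ e0) [d /= d0 hd].
have step h : `|h| < d -> h != 0 -> h^-1 * (H (h + t) - H t) < e.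
  move=> hlt h0; have := hd h; rewrite /= sub0r normrN => /(_ hlt h0).
  rewrite ltr_norml => /andP[h1 _].
  have : - e < derive1 H t - h^-1 * (H (h + t) - H t) by exact: h1.
  by move: H0; lra.
have rgt y : t <= y -> y - t < d -> H y - H t <= e * (y - t).
  rewrite le_eqVlt => /predU1P[->|ty] yd; first by rewrite !subrr mulr0.
  have yt : 0 < y - t by rewrite subr_gt0.
  have := step (y - t); rewrite gtr0_norm// subrK lt0r_neq0// => /(_ yd isT).
  by rewrite mulrC ltr_pdivrMr// => /ltW.
have lft x : x <= t -> t - x < d -> H t - H x <= e * (t - x).
  rewrite le_eqVlt => /predU1P[->|xt] xd; first by rewrite !subrr mulr0.
  have tx : 0 < t - x by rewrite subr_gt0.
  have := step (x - t); rewrite distrC gtr0_norm// subrK subr_eq0 lt_eqF// => /(_ xd isT).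
  rewrite -opprB invrN mulNr -mulrN opprB mulrC ltr_pdivrMr// => /ltW.
  by [].
exists d => // x y xt ty xd yd.
by have := rgt y ty yd; have := lft x xt xd; lra.
Qed.

(** The exceptional null set lies in an open set [U] of small measure, over which the increments of
    [H] are dominated by those of [c] and have a small sum; outside [U] the straddle inequality
    applies. The bound on the increments of [H] is one-sided so that terms known only to be
    nonincreasing can enter [H]. *)
Lemma abs_continuous_nonincreasing (R : realType) (n m : nat) (a b K : R)
    (c : R -> 'rV[R]_(2 * n + m)) (H : R -> R) :
  a <= b -> 0 <= K -> abs_continuous_on a b c ->
  (forall s t, a <= s -> s <= t -> t <= b -> H t - H s <= K * enorm (c t - c s)) ->
  {ae @lebesgue_measure R, forall t, `[a, b]%classic t ->
     derivable H t 1 /\ derive1 H t <= 0} ->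
  H b <= H a.
Proof.
move=> ab K0 ac HK ae.
suff step e : 0 < e -> H b - H a <= e * (b - a) + K * e.
  have ba : 0 < b - a + K + 1 by move: ab K0; lra.
  rewrite -subr_le0; apply/ler_addgt0Pr => e e0; rewrite add0r.
  have e1 : 0 < e / (b - a + K + 1) by rewrite divr_gt0.
  apply: le_trans (step _ e1) _.
  rewrite [K * _]mulrC -mulrDr -mulrA -[leRHS]mulr1 ler_pM2l// mulrC ler_pdivrMr//.
  by rewrite mul1r lerDl.
move=> e0; have [d d0 acd] := abs_continuous_sum ac e0.
case: ae => N [mN N0 badN].
have [U [oU NU]] := lebesgue_regularity_outer mN (eq_ind_r (fun x => (x < +oo)%E) (ltry 0) N0) d0.
move=> UNd.
have mU : measurable U by exact: open_measurable.
have Ud : (@lebesgue_measure R U < d%:E)%E.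
  have -> : U = (U `\` N) `|` N by rewrite setUC setDUK.
  apply: le_lt_trans UNd; rewrite measureU0//; exact: measurableD.
(* The list records the subintervals lying in [U]; the increments over the other subintervals are
   absorbed by [e * (y - x)]. *)
pose P x y := exists l : seq (R * R),
  [/\ pairwise (fun p q : R * R => p.2 <= q.1) l,
      forall p, p \in l -> [/\ x <= p.1, p.1 <= p.2, p.2 <= y & `]p.1, p.2[%classic `<=` U] &
      H y - H x <= e * (y - x) + K * \sum_(p <- l) enorm (c p.2 - c p.1)].
have [l [pl lU Hl]] : P a b.
  apply: cousin_additive => //.
    move=> x y z ax xy yz zb [l1 [p1 U1 H1]] [l2 [p2 U2 H2]].
    exists (l1 ++ l2); split.
    - rewrite pairwise_cat p1 p2 !andbT; apply/allrelP => p q /U1[_ _ py _] /U2[yq _ _ _].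
      exact: le_trans yq.
    - move=> p; rewrite mem_cat => /orP[/U1[? ? ? ?]|/U2[? ? ? ?]]; split=> //.
        exact: le_trans yz.
      exact: le_trans xy _.
    - by rewrite big_cat /= mulrDr; move: H1 H2; lra.
  (* Near a point of [U] the whole interval goes into the list; near any other point the list is
     empty. *)
  move=> t at_ tb; have [tU|tU] := pselect (U t).
    have [r /= r0 rU] : nbhs t U by exact: open_nbhs_nbhs.
    exists r => // x y ax xt ty yb xr yr; exists [:: (x, y)]; split=> //.
      move=> p; rewrite inE => /eqP -> /=; split=> //; first exact: le_trans ty.
      move=> z /=; rewrite in_itv /= => /andP[xz zy]; apply: rU.
      by rewrite /ball_ /= ltr_norml; lra.
    rewrite big_seq1 /=; apply: le_trans (HK _ _ ax (le_trans xt ty) yb) _.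
    by rewrite lerDr mulr_ge0 ?(ltW e0)// subr_ge0 (le_trans xt).
  have [dH H0] : derivable H t 1 /\ derive1 H t <= 0.
    apply: contrapT => bad; apply: tU; apply: NU; apply: badN => /= h.
    by apply: bad; apply: h; rewrite /= in_itv /= at_ tb.
  have [r r0 hr] := derive1_le0_near dH H0 e0.
  exists r => // x y ax xt ty yb xr yr; exists [::]; split=> //.
  by rewrite big_nil mulr0 addr0; exact: hr.
apply: le_trans Hl _; rewrite lerD2l ler_wpM2l// ltW//.
exact: (acd l U).
Qed.

(** * H-type algebras *)

Section edot_theory.
Variables (R : realType) (k : nat).
Implicit Types u v w : 'rV[R]_k.

Lemma edotC u v : edot u v = edot v u.
Proof. by apply: eq_bigr => i _; rewrite mulrC. Qed.

Lemma edotDl u v w : edot (u + v) w = edot u w + edot v w.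
Proof. by rewrite -big_split; apply: eq_bigr => i _; rewrite mxE mulrDl. Qed.

Lemma edotDr u v w : edot w (u + v) = edot w u + edot w v.
Proof. by rewrite edotC edotDl !(edotC w). Qed.

Lemma edotZl (a : R) u v : edot (a *: u) v = a * edot u v.
Proof. by rewrite mulr_sumr; apply: eq_bigr => i _; rewrite mxE mulrA. Qed.

Lemma edotZr (a : R) u v : edot u (a *: v) = a * edot u v.
Proof. by rewrite edotC edotZl edotC. Qed.

Lemma edotNl u v : edot (- u) v = - edot u v.
Proof. by rewrite -scaleN1r edotZl mulN1r. Qed.

Lemma edotBl u v w : edot (u - v) w = edot u w - edot v w.
Proof. by rewrite edotDl edotNl. Qed.

Lemma edotBr u v w : edot w (u - v) = edot w u - edot w v.
Proof. by rewrite edotC edotBl !(edotC w). Qed.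

Lemma edot_ge0 u : 0 <= edot u u.
Proof. by apply: sumr_ge0 => i _; rewrite -expr2 sqr_ge0. Qed.

Lemma edot_eq0 u : edot u u = 0 -> u = 0.
Proof.
move=> /eqP; rewrite psumr_eq0 => [/allP u0|i _]; last by rewrite -expr2 sqr_ge0.
apply/rowP => i; rewrite mxE; apply/eqP.
by have := u0 i (mem_index_enum i); rewrite mulf_eq0 orbb.
Qed.

Lemma edot_ext u v : (forall w, edot u w = edot v w) -> u = v.
Proof. by move=> uv; apply/rowP => i; rewrite -!edot_delta. Qed.

Lemma enorm_ge0 u : 0 <= enorm u.
Proof. exact: sqrtr_ge0. Qed.

Lemma enorm_sqr u : enorm u ^+ 2 = edot u u.
Proof. by rewrite sqr_sqrtr// edot_ge0. Qed.

Lemma enorm0 : enorm (0 : 'rV[R]_k) = 0.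
Proof. by rewrite /enorm edot0r sqrtr0. Qed.

Lemma enorm_gt0 u : u != 0 -> 0 < enorm u.
Proof.
move=> u0; rewrite lt_def enorm_ge0 andbT; apply: contra u0 => /eqP u0.
by apply/eqP/edot_eq0; rewrite -enorm_sqr u0 expr0n.
Qed.

Lemma enormZ (a : R) u : 0 <= a -> enorm (a *: u) = a * enorm u.
Proof.
move=> a0; rewrite /enorm edotZl edotZr mulrA -expr2 sqrtrM ?sqr_ge0//.
by rewrite sqrtr_sqr ger0_norm.
Qed.

(** Cauchy-Schwarz, from the nonnegativity of the square of [|v| u - |u| v]. *)
Lemma edot_le_enorm u v : edot u v <= enorm u * enorm v.
Proof.
have [->|u0] := eqVneq u 0; first by rewrite edot0l enorm0 mul0r.
have [->|v0] := eqVneq v 0; first by rewrite edot0r enorm0 mulr0.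
have pu := enorm_gt0 u0; have pv := enorm_gt0 v0.
have := edot_ge0 (enorm v *: u - enorm u *: v).
have -> : edot (enorm v *: u - enorm u *: v) (enorm v *: u - enorm u *: v) =
    2 * (enorm u * enorm v) * (enorm u * enorm v - edot u v).
  rewrite !(edotDl, edotDr) -!scaleNr !(edotZl, edotZr) (edotC v u) -!enorm_sqr.
  by ring.
by rewrite pmulr_rge0 ?subr_ge0// !mulr_gt0.
Qed.

Lemma norm_edot_le u v : `|edot u v| <= enorm u * enorm v.
Proof.
rewrite ler_norml edot_le_enorm andbT lerNl -edotNl.
by rewrite (le_trans (edot_le_enorm _ _))// /enorm -scaleN1r edotZl edotZr mulrA mulN1r opprK mul1r.
Qed.

End edot_theory.

Section htype_calculus.
Variables (R : realType) (n m : nat).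
Variable br : {bilinear 'rV[R]_(2 * n + m) -> 'rV[R]_(2 * n + m) ->
                        'rV[R]_(2 * n + m)}.
Hypothesis Hbr : htype_group br.
Implicit Types (x y a : 'rV[R]_(2 * n)) (u w z : 'rV[R]_m).

Definition hbr x y : 'rV[R]_m := rsubmx (br (row_mx x 0) (row_mx y 0)).

Definition Jop u x : 'rV[R]_(2 * n) :=
  lsubmx (Jmap (@edot R (2 * n + m)) br (row_mx 0 u) (row_mx x 0)).

Let cE : Defs.center br = [set row_mx 0 z | z in [set: 'rV[R]_m]] := Hbr.2.

Let row_mx0D x y : row_mx (x + y) (0 : 'rV[R]_m) = row_mx x 0 + row_mx y 0.
Proof. by rewrite add_row_mx addr0. Qed.

Let row_mx0Z (t : R) x : row_mx (t *: x) (0 : 'rV[R]_m) = t *: row_mx x 0.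
Proof. by rewrite scale_row_mx scaler0. Qed.

Lemma orth_center_row_mx x :
  orth_compl (@edot R (2 * n + m)) (Defs.center br) (row_mx x 0).
Proof. by apply/orth_compl_center => //; rewrite row_mxKr. Qed.

(** Brackets of horizontal vectors are central by the H-type axiom, so the projection in [hbr] loses
    nothing. *)
Lemma br_row_mx0 x y : br (row_mx x 0) (row_mx y 0) = row_mx 0 (hbr x y).
Proof.
have : Defs.center br (br (row_mx x 0) (row_mx y 0)).
  case: Hbr => -[_ <- _] _; exists 1%N, (fun=> 1), (fun=> br (row_mx x 0) (row_mx y 0)).
  split=> [_|]; last by rewrite big_ord1 scale1r.
  by exists (row_mx x 0), (row_mx y 0); split=> //; exact: orth_center_row_mx.
by rewrite cE /hbr => -[z _ <-]; rewrite row_mxKr.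
Qed.

Lemma hbrDl x y a : hbr (x + y) a = hbr x a + hbr y a.
Proof. by rewrite /hbr row_mx0D linearDl linearD. Qed.

Lemma hbrDr x y a : hbr a (x + y) = hbr a x + hbr a y.
Proof. by rewrite /hbr row_mx0D linearDr linearD. Qed.

Lemma hbrZl (t : R) x y : hbr (t *: x) y = t *: hbr x y.
Proof. by rewrite /hbr row_mx0Z linearZl /= linearZ. Qed.

Lemma hbrZr (t : R) x y : hbr x (t *: y) = t *: hbr x y.
Proof. by rewrite /hbr row_mx0Z linearZr /= linearZ. Qed.

Lemma hbrxx x : hbr x x = 0.
Proof. by case: Hbr => -[[alt _] _ _] _; rewrite /hbr alt linear0. Qed.

Lemma hbrC x y : hbr x y = - hbr y x.
Proof.
apply/eqP; rewrite -addr_eq0; apply/eqP.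
by have := hbrxx (x + y); rewrite hbrDl !hbrDr !hbrxx add0r addr0.
Qed.

Lemma hpart_row_mx x z : hpart (row_mx x z) = row_mx x 0.
Proof. by rewrite /hpart row_mxKl. Qed.

Lemma Jmap_row_mx u x :
  Jmap (@edot R (2 * n + m)) br (row_mx 0 u) (row_mx x 0) = row_mx (Jop u x) 0.
Proof.
have [J0 _] := Jmap_hpart (row_mx 0 u) (row_mx x 0) 0 cE.
by rewrite -(hpart_row_mx x 0) -[LHS]hsubmxK J0 /Jop hpart_row_mx.
Qed.

Lemma edot_Jop u x y : edot (Jop u x) y = edot u (hbr x y).
Proof.
have [_] := Jmap_hpart (row_mx 0 u) (row_mx x 0) (row_mx y 0) cE.
rewrite !hpart_row_mx Jmap_row_mx br_row_mx0 !edot_row_mx.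
by rewrite !edot0r addr0 add0r.
Qed.

Lemma JopDl u w x : Jop (u + w) x = Jop u x + Jop w x.
Proof. by apply: edot_ext => y; rewrite edotDl !edot_Jop edotDl. Qed.

Lemma JopZl (t : R) u x : Jop (t *: u) x = t *: Jop u x.
Proof. by apply: edot_ext => y; rewrite edotZl !edot_Jop edotZl. Qed.

Lemma JopDr u x y : Jop u (x + y) = Jop u x + Jop u y.
Proof. by apply: edot_ext => a; rewrite edotDl !edot_Jop hbrDl edotDr. Qed.

Lemma JopZr (t : R) u x : Jop u (t *: x) = t *: Jop u x.
Proof. by apply: edot_ext => y; rewrite edotZl !edot_Jop hbrZl edotZr. Qed.

Lemma Jop_skew u x y : edot (Jop u x) y = - edot x (Jop u y).
Proof. by rewrite (edotC x) !edot_Jop hbrC edotC edotNl edotC. Qed.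

Lemma edot_Jop_self u x : edot (Jop u x) x = 0.
Proof. by rewrite edot_Jop hbrxx edot0r. Qed.

Lemma Jop_isometry u x y : edot u u = 1 -> edot (Jop u x) (Jop u y) = edot x y.
Proof.
move=> u1; case: Hbr => -[_ _ orth] _.
have cu : Defs.center br (row_mx 0 u) by rewrite cE; exists u.
have n1 : Num.sqrt (edot (row_mx (0 : 'rV_(2 * n)) u) (row_mx 0 u)) = 1 :> R.
  by rewrite edot_row_mx edot0r add0r u1 sqrtr1.
have : edot (Jmap (@edot R (2 * n + m)) br (row_mx 0 u) (row_mx x 0))
    (Jmap (@edot R (2 * n + m)) br (row_mx 0 u) (row_mx y 0)) =
    edot (row_mx x 0) (row_mx y (0 : 'rV[R]_m)).
  exact: orth _ cu n1 _ _ (orth_center_row_mx x) (orth_center_row_mx y).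
by rewrite !Jmap_row_mx !edot_row_mx !edot0r !addr0.
Qed.

(** For a unit [u], the map [J_u] is both skew and orthogonal, hence a complex structure. *)
Lemma JopK u x : edot u u = 1 -> Jop u (Jop u x) = - x.
Proof.
move=> u1; apply: edot_ext => y; rewrite Jop_skew edotNl.
by rewrite Jop_isometry.
Qed.

(** Linearity in [u] reduces this to a unit vector, where [J_u] is an isometry. *)
Lemma edot_Jop_sqr u x : edot (Jop u x) (Jop u x) = edot u u * edot x x.
Proof.
have [->|u0] := eqVneq u 0.
  have -> : Jop 0 x = 0 by apply: edot_ext => y; rewrite edot_Jop !edot0l.
  by rewrite !edot0l mul0r.
have pu := enorm_gt0 u0.
have [k [v [v1 ->]]] : exists (k : R) v, edot v v = 1 /\ u = k *: v.
  exists (enorm u), ((enorm u)^-1 *: u); split.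
    by rewrite edotZl edotZr -enorm_sqr; field; rewrite gt_eqF.
  by rewrite scalerA divff ?scale1r// gt_eqF.
by rewrite JopZl !edotZl !edotZr Jop_isometry// v1; ring.
Qed.

(* Polarizing |J_w x| = |w| |x| in w gives <J_w x, J_u x> = <w, u> |x|^2. *)
Lemma hbr_Jop u x : hbr x (Jop u x) = edot x x *: u.
Proof.
apply: edot_ext => w; rewrite edotZl edotC -edot_Jop (edotC u).
have := edot_Jop_sqr (w + u) x.
rewrite JopDl !(edotDl, edotDr) !edot_Jop_sqr (edotC (Jop u x)) (edotC u).
by lra.
Qed.

(** The central part of [X_i] is [[x, e_i] / 2], because [<J_{u_j} x, e_i> = <u_j, [x, e_i]>]; the
    rest is linearity. Horizontal velocities thus become pairs [(a, [x, a] / 2)]. *)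
Lemma sum_Xfield a x z :
  \sum_i a 0 i *: Xfield br i (row_mx x z) = row_mx a (2^-1 *: hbr x a).
Proof.
have XE i : Xfield br i (row_mx x z) =
    row_mx (delta_mx 0 i) (2^-1 *: hbr x (delta_mx 0 i)).
  rewrite /Xfield hpart_row_mx /evec.
  have -> : \sum_j edot (Jmap (@edot R (2 * n + m)) br (uvec R n j) (row_mx x 0))
      (row_mx (delta_mx 0 i) 0) *: uvec R n j = row_mx 0 (hbr x (delta_mx 0 i)).
    apply/rowP => k; rewrite summxE; case: (split_ordP k) => j ->.
      by rewrite row_mxEl mxE big1 // => l _; rewrite mxE row_mxEl mxE mulr0.
    rewrite row_mxEr (bigD1 j) //= big1 => [|l lj].
      rewrite mxE row_mxEr mxE !eqxx mulr1 addr0 /uvec Jmap_row_mx edot_row_mx.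
      by rewrite edot0r addr0 edot_Jop edotC edot_delta.
    by rewrite mxE row_mxEr mxE eq_sym (negbTE lj) andbF mulr0.
  by rewrite scale_row_mx scaler0 add_row_mx addr0 add0r.
have aE : a = \sum_i a 0 i *: delta_mx 0 i := row_sum_delta a.
under eq_bigr do rewrite XE scale_row_mx.
transitivity (row_mx (\sum_i a 0 i *: (delta_mx 0 i : 'rV[R]_(2 * n)))
   (\sum_i a 0 i *: (2^-1 *: hbr x (delta_mx 0 i)))).
  elim/big_rec3: _ => [|i p q r _ ->]; first by rewrite row_mx0.
  by rewrite add_row_mx.
rewrite -aE; congr row_mx.
have hbr0 : hbr x 0 = 0 by rewrite -(scale0r 0) hbrZr scale0r.
rewrite [in RHS]aE (big_morph (hbr x) (fun y1 y2 => hbrDr y1 y2 x) hbr0) scaler_sumr.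
by apply: eq_bigr => i _; rewrite hbrZr !scalerA mulrC.
Qed.

End htype_calculus.

(** * The function nu *)

Section is_derive_pointwise.
Variable R : realType.
Implicit Types (f g : R -> R) (x : R).

Lemma is_derive1D f g x df dg : is_derive x 1 f df -> is_derive x 1 g dg ->
  is_derive x 1 (fun t => f t + g t) (df + dg).
Proof. exact: is_deriveD. Qed.

Lemma is_derive1B f g x df dg : is_derive x 1 f df -> is_derive x 1 g dg ->
  is_derive x 1 (fun t => f t - g t) (df - dg).
Proof. exact: is_deriveB. Qed.

Lemma is_derive1M f g x df dg : is_derive x 1 f df -> is_derive x 1 g dg ->
  is_derive x 1 (fun t => f t * g t) (df * g x + f x * dg).
Proof.
move=> hf hg; apply: (@is_derive_eq _ _ _ _ _ _ _ (f x *: dg + g x *: df)).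
by rewrite addrC; congr (_ + _); rewrite [LHS]mulrC.
Qed.

Lemma is_derive1_scale f x (k df : R) : is_derive x 1 f df ->
  is_derive x 1 (fun t => k * f t) (k * df).
Proof. exact: is_deriveZ. Qed.

Lemma is_derive_derivable1 f x df :
  is_derive x 1 f df -> derivable f x 1 /\ derive1 f x = df.
Proof. by move=> [hf fE]; rewrite derive1E. Qed.

Lemma is_derive_within_continuous f (df : R -> R) (a b : R) :
  (forall t, a <= t <= b -> is_derive t 1 f (df t)) ->
  {within `[a, b], continuous f}.
Proof.
move=> fdf; apply: derivable_within_continuous => t; rewrite in_itv /= => h.
by have [] := fdf t h.
Qed.

Lemma is_derive_gt0_lt f (df : R -> R) (a b : R) :
  a < b -> (forall t, a <= t <= b -> is_derive t 1 f (df t)) ->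
  (forall t, a < t < b -> 0 < df t) -> f a < f b.
Proof.
move=> ab fdf df0.
have hd t : t \in `]a, b[ -> is_derive t 1 f (df t).
  by rewrite in_itv /= => /andP[h1 h2]; apply: fdf; rewrite !ltW.
have [t + E] := MVT ab hd (is_derive_within_continuous fdf).
rewrite in_itv /= => /df0 dft.
by rewrite -subr_gt0 E mulr_gt0// subr_gt0.
Qed.

End is_derive_pointwise.

Section trig.
Variable R : realType.
Implicit Types t y : R.

Lemma sin2E t : sin (2 * t) = 2 * (sin t * cos t).
Proof. by rewrite mulrC mulr_natr sin_mulr2n mulr2n; ring. Qed.

Lemma cos2E t : cos (2 * t) = 1 - 2 * sin t ^+ 2.
Proof.
rewrite mulrC mulr_natr cos_mulr2n mulr2n; have := cos2Dsin2 t; lra.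
Qed.

(** The function [sin s - s cos s] vanishes at 0 and has derivative [s sin s]. *)
Lemma id_cos_lt_sin t : 0 < t < pi -> t * cos t < sin t.
Proof.
move=> /andP[t0 tpi]; rewrite -subr_gt0.
pose f s : R := sin s - s * cos s.
have -> : 0 = f 0 by rewrite /f sin0 mul0r subrr.
apply: (@is_derive_gt0_lt _ f (fun s => s * sin s) 0 t) => // s sI.
  have D : is_derive s 1 f (cos s - (1 * cos s + s * - sin s)) :=
    is_derive1B (is_derive_sin s) (is_derive1M (is_derive_id s 1) (is_derive_cos s)).
  by apply: is_derive_eq D _; ring.
by case/andP: sI => s0 st; rewrite mulr_gt0// sin_gt0_pi// s0 (lt_trans st).
Qed.

Lemma nuE t : t != 0 -> nu t = (t - sin t * cos t) / sin t ^+ 2.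
Proof.
move=> t0; rewrite /nu (negbTE t0) sin2E cos2E.
have -> : 1 - (1 - 2 * sin t ^+ 2) = 2 * sin t ^+ 2 by ring.
rewrite -mulrBr -mulf_div divff ?mul1r//; exact: pnatr_eq0.
Qed.

(** The derivative of [nu] is [2 (sin r - r cos r) / sin^3 r], positive by [id_cos_lt_sin]. *)
Lemma nu_lt s t : 0 < s -> s < t -> t < pi -> nu s < nu t.
Proof.
move=> s0 st tpi; have t0 := lt_trans s0 st.
have sin0 r : s <= r <= t -> 0 < sin r.
  by move=> /andP[sr rt]; rewrite sin_gt0_pi// (lt_le_trans s0)// (le_lt_trans rt).
pose f r : R := (r - sin r * cos r) * (sin r * sin r)^-1.
rewrite !nuE ?gt_eqF// !expr2 -!/(f _).
apply: (@is_derive_gt0_lt _ f (fun r => 2 * (sin r - r * cos r) / sin r ^+ 3)) => // r rI.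
  have sr := sin0 r rI.
  have sr0 : sin r * sin r != 0 by rewrite mulf_neq0// gt_eqF.
  have DV : is_derive r 1 (fun t => (sin t * sin t)^-1) _ :=
    @is_deriveV R (fun t => sin t * sin t) r _ _ sr0 (is_derive1M (is_derive_sin r) (is_derive_sin r)).
  have D : is_derive r 1 f _ :=
    is_derive1M (is_derive1B (is_derive_id r 1)
      (is_derive1M (is_derive_sin r) (is_derive_cos r))) DV.
  apply: is_derive_eq D _; rewrite -[_ *: _]/(_ * _).
  have c2 : cos r ^+ 2 = 1 - sin r ^+ 2 by have := cos2Dsin2 r; lra.
  have -> : cos r * cos r + sin r * - sin r = 1 - 2 * sin r ^+ 2.
    by rewrite -expr2 c2; ring.
  (* After multiplication by [sin^4 r] the two sides differ by a multiple of
     [sin^2 r + cos^2 r - 1]. *)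
  apply: (mulIf (expf_neq0 4 (lt0r_neq0 sr))).
  apply/eqP; rewrite -subr_eq0; apply/eqP.
  transitivity (2 * sin r ^+ 2 * (sin r ^+ 2 + cos r ^+ 2 - 1)).
    field; exact: lt0r_neq0.
  by rewrite c2; ring.
case/andP: rI => sr rt; have r0 := sin0 r; rewrite !ltW// in r0.
rewrite divr_gt0 ?exprn_gt0 ?r0// mulr_gt0// subr_gt0 id_cos_lt_sin//.
by rewrite (lt_trans s0) ?(lt_trans rt).
Qed.


(** With [y = sin t / cos t] the claim reduces to [t cos t <= sin t]. It gives an explicit left
    endpoint for the intermediate value theorem, in place of the limit of [nu] at 0. *)
Lemma nu_atan_le y : 0 < y -> nu (atan y) <= y.
Proof.
move=> y0; have a0 : 0 < atan y by rewrite -atan0 lt_atan.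
have a2 := atan_ltpi2 y.
have pi0 := pi_gt0 R.
have c0 : 0 < cos (atan y) by rewrite cos_gt0_pihalf// a2 andbT; lra.
have s0 : 0 < sin (atan y) by rewrite sin_gt0_pi// a0; lra.
have api : 0 < atan y < pi by rewrite a0; lra.
have sE : sin (atan y) = y * cos (atan y).
  have := atanK y; rewrite /tan; move: (sin _) (cos _) c0 => s c c0 <-.
  by rewrite divfK// gt_eqF.
rewrite nuE ?gt_eqF//; move: (cos2Dsin2 (atan y)) (id_cos_lt_sin api) sE s0 c0.
move: (sin _) (cos _) => s c sc1 h sE s0 c0.
rewrite ler_pdivrMr ?exprn_gt0// -(ler_pM2r c0).
have -> : y * s ^+ 2 * c = s * (1 - c ^+ 2) by rewrite -sc1 sE; ring.
have -> : (atan y - s * c) * c = atan y * c - s * c ^+ 2 by ring.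
by rewrite mulrBr mulr1 lerD2r ltW.
Qed.

Lemma nu_surj y : 0 < y -> exists2 t, 0 < t < pi & nu t = y.
Proof.
move=> y0; have a0 : 0 < atan y by rewrite -atan0 lt_atan.
have pi0 := pi_gt0 R.
have api : atan y < pi by have := atan_ltpi2 y; lra.
(* Clearing the denominator of [nu t = y] gives a function continuous up to [pi], where [nu] blows
   up; there [f pi = pi > 0], so the zero found is not [pi]. *)
pose f t : R := t - sin t * cos t - y * (sin t * sin t).
have cf : {within `[atan y, pi], continuous f}.
  have D t : is_derive t 1 f _ := is_derive1B
    (is_derive1B (is_derive_id t 1) (is_derive1M (is_derive_sin t) (is_derive_cos t)))
    (is_derive1_scale y (is_derive1M (is_derive_sin t) (is_derive_sin t))).
  exact: (is_derive_within_continuous (fun t _ => D t)).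
have sin0 r : atan y <= r < pi -> 0 < sin r.
  by move=> /andP[ar rp]; rewrite sin_gt0_pi// rp andbT (lt_le_trans a0).
have fa : f (atan y) <= 0.
  have sa := sin0 (atan y); rewrite lexx api in sa.
  have := nu_atan_le y0; rewrite nuE ?gt_eqF// ler_pdivrMr ?exprn_gt0 ?sa//.
  by rewrite /f -expr2 subr_le0.
have fpi : 0 < f pi by rewrite /f sinpi !mul0r mulr0 !subr0.
have f0 : Num.min (f (atan y)) (f pi) <= 0 <= Num.max (f (atan y)) (f pi).
  by rewrite ge_min fa le_max (ltW fpi) orbT.
have [t] := IVT (ltW api) cf f0.
rewrite in_itv /= => /andP[at_ tpi] ft.
have tp : t < pi.
  by rewrite lt_neqAle tpi andbT; apply/eqP => tE; rewrite -tE ft ltxx in fpi.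
have t0 := lt_le_trans a0 at_.
exists t; rewrite ?t0//; have st := sin0 t; rewrite at_ tp in st.
rewrite nuE ?gt_eqF//; apply: (canLR (mulfK _)); first by rewrite expf_neq0 ?gt_eqF ?st.
by apply/eqP; rewrite -subr_eq0 expr2; apply/eqP.
Qed.

Lemma nu_unique_root y : 0 < y ->
  exists2 t, 0 < t < pi & unique (fun t => 0 <= t < pi /\ nu t = y) t.
Proof.
move=> y0; have [t tI nut] := nu_surj y0; exists t => //.
have /andP[t0 tpi] := tI; split; first by rewrite (ltW t0).
move=> s [/andP[s0 spi] nus].
have sn0 : s != 0.
  by apply/eqP => sE; move: y0; rewrite -nus sE /nu eqxx ltxx.
have sgt0 : 0 < s by rewrite lt_neqAle eq_sym sn0.
have [ts|st|->//] := ltgtP t s.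
  by have := nu_lt t0 ts spi; rewrite nut nus ltxx.
by have := nu_lt sgt0 st tpi; rewrite nut nus ltxx.
Qed.

End trig.

(** * Arclength of a horizontal curve *)

Section le_integral_subset.
Import HBNNSimple.

(* The integrand of [path_length] need not be measurable a priori, so the
   monotonicity lemmas of the library, which ask for measurability, do not apply. *)
Lemma le_integral_subset d (T : measurableType d) (R : realType)
    (mu : {measure set T -> \bar R}) (A B : set T) (f : T -> \bar R) :
  A `<=` B -> (forall x, B x -> (0 <= f x)%E) ->
  (\int[mu]_(x in A) f x <= \int[mu]_(x in B) f x)%E.
Proof.
move=> AB f0; rewrite !ge0_integralE//; last by move=> x /AB /f0.
apply: ereal_sup_le => _ [h /= hf <-]; exists h => // x; apply: le_trans (hf x) _.
rewrite /patch; case: ifPn => [xA|_].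
  by rewrite ifT// inE; apply: AB; exact: set_mem xA.
case: ifPn => [xB|_]; last exact: lexx.
by apply: f0; exact: set_mem xB.
Qed.

End le_integral_subset.

Lemma norm_coord_le (R : realType) k (u : 'rV[R]_k) i : `|u 0 i| <= enorm u.
Proof.
have := norm_edot_le u (delta_mx 0 i); rewrite edot_delta.
by rewrite [X in _ * X]/enorm edot_delta mxE !eqxx sqrtr1 mulr1.
Qed.

Section arclength.
Variables (R : realType) (n m : nat).
Local Notation G := 'rV[R]_(2 * n + m).
Implicit Types c : R -> G.

Lemma abs_continuous_uniform c (a b e : R) : abs_continuous_on a b c -> 0 < e ->
  exists2 d : R, 0 < d & forall s t, a <= s -> s <= t -> t <= b -> t - s < d ->
    enorm (c t - c s) < e.
Proof.
move=> ac e0; have [d d0 acd] := ac e e0; exists d => // s t as_ st tb tsd.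
have := acd 1%N (fun=> s) (fun=> t); rewrite !big_ord1; apply=> //.
by apply/trivIsetP => i j _ _; rewrite !ord1.
Qed.

(** A horizontal path is controlled on [[0, 1]] only; composed with this retraction it becomes
    continuous, hence measurable, on the whole line. *)
Definition clamp01 (t : R) : R := Num.max 0 (Num.min t 1).

Lemma clamp01_id t : 0 <= t <= 1 -> clamp01 t = t.
Proof.
by move=> /andP[t0 t1]; rewrite /clamp01 (min_idPl t1) (max_idPr t0).
Qed.

Lemma clamp01_itv t : 0 <= clamp01 t <= 1.
Proof. by rewrite /clamp01 le_max lexx ge_max ler01 ge_min lexx orbT. Qed.

Lemma clamp01_dist s t : s <= t -> 0 <= clamp01 t - clamp01 s <= t - s.
Proof.
move=> st; rewrite /clamp01; case: (leP t 1) => ?; case: (leP s 1) => ?;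
  case: (leP 0 t) => ?; case: (leP 0 s) => ?; rewrite ?(max_r ler01); lra.
Qed.

Lemma continuous_clamped c i : abs_continuous_on 0 1 c ->
  continuous (fun t : R => c (clamp01 t) 0 i).
Proof.
move=> ac t; apply/cvgrPdist_lt => e e0.
have [d d0 acd] := abs_continuous_uniform ac e0.
have key s r : s <= r -> r - s < d ->
    `|c (clamp01 r) 0 i - c (clamp01 s) 0 i| < e.
  move=> sr srd; have := norm_coord_le (c (clamp01 r) - c (clamp01 s)) i.
  rewrite !mxE => /le_lt_trans; apply.
  have /andP[h1 h2] := clamp01_dist sr.
  have /andP[s0 s1] := clamp01_itv s; have /andP[r0 r1] := clamp01_itv r.
  by apply: acd => //; [rewrite -subr_ge0|exact: le_lt_trans srd].
exists d => // s /=; rewrite ltr_norml => /andP[ts1 ts2].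
have [ts|/ltW st] := leP t s; last by apply: key => //; lra.
by rewrite distrC; apply: key => //; lra.
Qed.

(** The derivative is the pointwise limit of the difference quotients of step [1 / (k + 1)], which
    are measurable since the clamped path is continuous. *)
Lemma measurable_derive_coord c i (D : set R) : abs_continuous_on 0 1 c ->
  measurable D -> D `<=` `[0, 1[%classic -> (forall t, D t -> derivable c t 1) ->
  measurable_fun D (fun t => derive1 c t 0 i).
Proof.
move=> ac mD D01 dc.
pose h (k : nat) (t : R) : R :=
  k.+1%:R * (c (clamp01 (t + k.+1%:R^-1)) 0 i - c (clamp01 t) 0 i).
have cc := @continuous_clamped c i ac.
apply: (@measurable_fun_cvg _ _ _ D h).
  move=> k; apply: measurable_funS (subsetT D) _ => //.
  apply: measurable_funM => //; apply: measurable_funB.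
    apply: continuous_measurable_fun => t.
    apply: (@continuous_comp _ _ _ (fun t : R => t + k.+1%:R^-1)
      (fun t => c (clamp01 t) 0 i)); last exact: cc.
    by apply: cvgD; [exact: cvg_id|exact: cvg_cst].
  exact: continuous_measurable_fun.
move=> t Dt; have /D01 /= := Dt; rewrite in_itv /= => /andP[t0 t1].
have dct := dc _ Dt.
have dcti := (derivable_mxP c t 1).1 dct 0 i.
have -> : derive1 c t 0 i = 'D_1 (fun s => c s 0 i) t.
  by rewrite derive1E derive_mx// mxE.
have cvD : r^-1 *: (c (r + t) 0 i - c t 0 i) @[r --> 0^'] --> 'D_1 (fun s => c s 0 i) t.
  by under eq_fun do rewrite -[X in c (X + t)]mulr1; exact: dcti.
apply/cvgrPdist_lt => e e0.
have /cvgrPdist_lt /(_ _ e0) [d /= d0 hd] := cvD.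
(* The bound [1 - t], positive because [D] omits 1, keeps [t + 1 / (k + 1)] in [[0, 1]], where
   clamping changes nothing. *)
have d10 : 0 < Num.min d (1 - t) by rewrite lt_min d0 subr_gt0.
near=> k.
have : k.+1%:R^-1 < Num.min d (1 - t).
  by near: k; exact: (near_infty_natSinv_lt (PosNum d10)).
rewrite lt_min => /andP[kd kt].
have k0 : 0 < k.+1%:R^-1 :> R by rewrite invr_gt0 ltr0n.
have := hd k.+1%:R^-1; rewrite /= sub0r normrN gtr0_norm// => /(_ kd).
rewrite gt_eqF// => /(_ isT); rewrite invrK.
have c1 : 0 <= k.+1%:R^-1 + t <= 1.
  by rewrite addr_ge0 ?(ltW k0)//= -lerBrDr ltW.
have c2 : 0 <= t <= 1 by rewrite t0 ltW.
by rewrite /h [t + _]addrC !clamp01_id.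
Unshelve. all: by end_near. Qed.

Variable br : {bilinear G -> G -> G}.
Hypothesis Hbr : htype_group br.

Lemma span_Xfield p v : linear_span [set Xfield br i p | i in setT] v ->
  v = row_mx (lsubmx v) (2^-1 *: hbr br (lsubmx p) (lsubmx v)).
Proof.
move=> [k [a [w [wX ->]]]].
elim/big_rec: _ => [|i v' _ IH].
  have -> : lsubmx (0 : G) = 0 by apply/matrixP => ? ?; rewrite !mxE.
  by rewrite -(scale0r (0 : 'rV_(2 * n))) (hbrZr br) !scale0r scaler0 row_mx0.
have [j _ <-] := wX i.
have XE : Xfield br j p = row_mx (delta_mx 0 j) (2^-1 *: hbr br (lsubmx p) (delta_mx 0 j)).
  have := sum_Xfield Hbr (delta_mx 0 j) (lsubmx p) (rsubmx p); rewrite hsubmxK => <-.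
  rewrite (bigD1 j)//= big1 => [|l lj]; first by rewrite !mxE !eqxx scale1r addr0.
  by rewrite mxE (negbTE lj) andbF scale0r.
rewrite {1}IH XE scale_row_mx add_row_mx linearD linearZ /= row_mxKl.
by rewrite hbrDr hbrZr; congr row_mx; rewrite scalerDr !scalerA mulrC.
Qed.

(** The horizontal part of a combination of the [X_i] is its coordinate vector, so the choice made
    in [hcoord] is forced. *)
Lemma hcoord_lsubmx c t :
  linear_span [set Xfield br i (c t) | i in setT] (derive1 c t) ->
  hcoord br c t = lsubmx (derive1 c t).
Proof.
move=> /span_Xfield dE; rewrite /hcoord; case: xgetP => [a _ ->|].
  by rewrite -(hsubmxK (c t)) sum_Xfield// row_mxKl.
by move=> /(_ (lsubmx (derive1 c t)))[] /=; rewrite -(hsubmxK (c t)) sum_Xfield.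
Qed.


(** [L] is the integral of the speed, put equal to 0 off a measurable set of full measure in
    [[0, 1]]. Finite length makes this function integrable, and Lebesgue differentiation gives
    [L' = |a|] almost everywhere. *)
Lemma arclength c : horizontal br c -> (path_length br c < +oo)%E ->
  exists L : R -> R, [/\ forall t, 0 <= L t, {homo L : s t / s <= t},
    ((L 1)%:E <= path_length br c)%E &
    {ae @lebesgue_measure R, forall t, `[0, 1]%classic t -> exists a,
      [/\ derivable c t 1,
          derive1 c t = row_mx a (2^-1 *: hbr br (lsubmx (c t)) a),
          derivable L t 1 & derive1 L t = enorm a]}].
Proof.
move=> [ac aec] lfin; pose mu := @lebesgue_measure R.
case: (aec) => N [mN N0 badN].
(* The endpoint 1 is left out because forward difference quotients at 1 leave [[0, 1]]. *)
pose D : set R := `[0, 1[%classic `\` N.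
have mD : measurable D by apply: measurableD => //; exact: measurable_itv.
have D01 : D `<=` `[0, 1[%classic by move=> t [].
have D01c : D `<=` `[0, 1]%classic by move=> t /D01 /=; rewrite !in_itv /= => /andP[-> /ltW].
have good t : D t -> derivable c t 1 /\
    linear_span [set Xfield br i (c t) | i in setT] (derive1 c t).
  move=> Dt; apply: contrapT => bad; case: (Dt) => _; apply; apply: badN => /= h.
  by apply: bad; apply: h; exact: D01c.
pose v t := enorm (hcoord br c t).
have mv : measurable_fun D v.
  apply: (@eq_measurable_fun _ _ _ _ D (fun t => Num.sqrt
      (\sum_(i < 2 * n) derive1 c t 0 (lshift m i) ^+ 2))).
    move=> t /set_mem /good[_ /hcoord_lsubmx hE]; rewrite /v /enorm /edot hE.
    by congr Num.sqrt; apply: eq_bigr => i _; rewrite mxE expr2.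
  apply: measurableT_comp.
    by apply: continuous_measurable_fun; exact: sqrt_continuous.
  apply: measurable_sum => i; apply: measurable_funX.
  by apply: measurable_derive_coord => // t /good[].
pose g := v \_ D.
have g0 t : 0 <= g t by rewrite /g patchE; case: ifP => _; [exact: enorm_ge0|exact: lexx].
have mg : measurable_fun setT g by exact: (measurable_restrictT _ mD).1 mv.
have intg : (\int[mu]_t (g t)%:E <= path_length br c)%E.
  have -> : (\int[mu]_t (g t)%:E = \int[mu]_(t in D) (v t)%:E)%E.
    rewrite [RHS]integral_mkcond; apply: eq_integral => t _.
    by rewrite /g !patchE; case: ifP.
  by apply: le_integral_subset => // t _; rewrite lee_fin; exact: enorm_ge0.
have ig : mu.-integrable setT (EFin \o g).
  apply/integrableP; split; first exact/measurable_EFinP.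
  under eq_integral do rewrite /= ger0_norm//.
  exact: le_lt_trans lfin.
have igS A : measurable A -> mu.-integrable A (EFin \o g).
  by move=> mA; apply: integrableS ig.
pose L t : R := (\int[mu]_(s in `]-oo, t]) (g s))%R.
have LE t : (L t)%:E = (\int[mu]_(s in `]-oo, t]) (g s)%:E)%E.
  by rewrite /L /Rintegral fineK//; apply: integrable_fin_num => //; exact: igS.
exists L; split.
- by move=> t; apply: Rintegral_ge0.
- move=> s t st; rewrite -lee_fin !LE; apply: le_integral_subset => [x|x _].
    by rewrite /= !in_itv /= => /le_trans; apply.
  by rewrite lee_fin.
- rewrite LE; apply: le_trans intg; apply: le_integral_subset => // x _.
  by rewrite lee_fin.
have loc : locally_integrable setT g by apply: open_integrable_locally => //; exact: openT.
have FTC := @FTC1Ny R g (fun y => igS _ (measurable_itv _)) loc.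
have N1 : {ae mu, forall t : R, t != 1}.
  exists [set 1]; split; [exact: measurable_set1|exact: lebesgue_measure_set1|].
  by move=> t /= /negP /negPn /eqP.
have NN : {ae mu, forall t, ~ N t}.
  by exists N; split=> // t /= /contrapT.
apply: (@filterS3 _ _ (ae_filter_ringOfSetsType lebesgue_measure) _ _ _ _ _ FTC N1 NN).
(* Off the null sets [N], [{1}] and that of Lebesgue differentiation, [t] lies in [D], where [g] is
   the true speed. *)
move=> t [dL LE'] tn1 tnN t01; have Dt : D t.
  split=> //.
  move: t01; rewrite /= !in_itv /= => /andP[-> t1] /=.
  by rewrite lt_neqAle t1 andbT.
have [dc sp] := good _ Dt.
exists (hcoord br c t); split=> //.
  by rewrite (hcoord_lsubmx sp); exact: span_Xfield.
by rewrite LE' /g patchE mem_set.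
Qed.

End arclength.

(** * The lower bound *)

Section enorm_blocks.
Variables (R : realType).

Lemma enormD_le k (u v : 'rV[R]_k) : enorm (u + v) <= enorm u + enorm v.
Proof.
rewrite -(@ler_pXn2r _ 2)// ?nnegrE ?addr_ge0 ?enorm_ge0//.
rewrite sqrrD !enorm_sqr !(edotDl, edotDr) (edotC v u).
by have := edot_le_enorm u v; lra.
Qed.

Lemma edot_hsubmx n m (p : 'rV[R]_(2 * n + m)) :
  edot p p = edot (lsubmx p) (lsubmx p) + edot (rsubmx p) (rsubmx p).
Proof. by rewrite -edot_row_mx hsubmxK. Qed.

Lemma enorm_lsubmx_le n m (p : 'rV[R]_(2 * n + m)) : enorm (lsubmx p) <= enorm p.
Proof. by rewrite /enorm ler_sqrt ?edot_ge0// edot_hsubmx lerDl edot_ge0. Qed.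

Lemma enorm_rsubmx_le n m (p : 'rV[R]_(2 * n + m)) : enorm (rsubmx p) <= enorm p.
Proof. by rewrite /enorm ler_sqrt ?edot_ge0// edot_hsubmx lerDr edot_ge0. Qed.

Lemma is_derive_edot k (p q : R -> 'rV[R]_k) (dp dq : 'rV[R]_k) (t : R) :
  (forall i, is_derive t 1 (fun s => p s 0 i) (dp 0 i)) ->
  (forall i, is_derive t 1 (fun s => q s 0 i) (dq 0 i)) ->
  is_derive t 1 (fun s => edot (p s) (q s)) (edot dp (q t) + edot (p t) dq).
Proof.
move=> hp hq.
have -> : (fun s => edot (p s) (q s)) = \sum_(i < k) (fun s => p s 0 i * q s 0 i).
  by apply/funext => s; rewrite fct_sumE.
rewrite /edot -big_split; apply: is_derive_sum => i.
exact: is_derive1M.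
Qed.

Lemma is_derive_coord k (c : R -> 'rV[R]_k) (t : R) i : derivable c t 1 ->
  is_derive t 1 (fun s => c s 0 i) (derive1 c t 0 i).
Proof.
move=> dc; rewrite derive1E derive_mx// mxE.
by apply: DeriveDef => //; exact: (derivable_mxP c t 1).1.
Qed.

Lemma exists_direction k (z : 'rV[R]_k) : (0 < k)%N ->
  exists u, edot u u = 1 /\ z = enorm z *: u.
Proof.
move=> k0; have [->|z0] := eqVneq z 0.
  exists (delta_mx 0 (Ordinal k0)).
  by rewrite edot_delta mxE !eqxx enorm0 scale0r.
exists ((enorm z)^-1 *: z); have pz := enorm_gt0 z0.
rewrite edotZl edotZr -enorm_sqr; split; first by field; rewrite gt_eqF.
by rewrite scalerA divff ?scale1r// gt_eqF.
Qed.

End enorm_blocks.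

(** * The Riccati equation and the monotonicity of its solution *)

Section cot.
Variable R : realType.

(* Solution of the Riccati equation y' = -2 y^2 - k^2 / 8. *)
Definition riccati (k s : R) := k / 4 * (cos (k / 2 * s) / sin (k / 2 * s)).

(** Over a common denominator the difference of the two sides has numerator [sin (t - s)]. *)
Lemma cot_le (s t : R) : 0 < s -> s <= t -> t < pi -> cos t / sin t <= cos s / sin s.
Proof.
move=> s0 st tpi.
have ps : 0 < sin s by rewrite sin_gt0_pi// s0 (le_lt_trans st).
have pt : 0 < sin t by rewrite sin_gt0_pi// tpi (lt_le_trans s0).
rewrite ler_pdivrMr// mulrAC ler_pdivlMr// -subr_ge0.
have -> : cos s * sin t - cos t * sin s = sin (t - s) by rewrite sinB; ring.
apply: sin_ge0_pi; lra.
Qed.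

Lemma riccati_le k e T s t : 0 < k -> 0 < e -> k / 2 * T < pi ->
  e <= s -> s <= t -> t <= T -> riccati k t <= riccati k s.
Proof.
move=> k0 e0 kT es st tT; have k2 : 0 < k / 2 by rewrite divr_gt0.
rewrite /riccati ler_pM2l ?divr_gt0//; apply: cot_le.
- by rewrite mulr_gt0// (lt_le_trans e0).
- by rewrite ler_pM2l.
- by apply: le_lt_trans kT; rewrite ler_pM2l.
Qed.

Lemma is_derive_riccati k s : 0 < k -> 0 < s -> k / 2 * s < pi ->
  is_derive s 1 (riccati k) (- 2 * riccati k s ^+ 2 - k ^+ 2 / 8).
Proof.
move=> k0 s0 ks.
have k2 : 0 < k / 2 * s by rewrite mulr_gt0// divr_gt0.
have sn0 : sin (k / 2 * s) != 0 by rewrite gt_eqF// sin_gt0_pi// k2.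
have Dl : is_derive s 1 (fun s => k / 2 * s) (k / 2 * 1) :=
  is_derive1_scale (k / 2) (is_derive_id s 1).
have Dc : is_derive s 1 (fun s => cos (k / 2 * s)) _ :=
  is_derive1_comp (is_derive_cos (k / 2 * s)) Dl.
have Ds : is_derive s 1 (fun s => sin (k / 2 * s)) _ :=
  is_derive1_comp (is_derive_sin (k / 2 * s)) Dl.
have Di := @is_deriveV R (fun s => sin (k / 2 * s)) s _ _ sn0 Ds.
have D : is_derive s 1 (riccati k) _ := is_derive1_scale (k / 4) (is_derive1M Dc Di).
apply: is_derive_eq D _; rewrite -[_ *: _]/(_ * _) /riccati.
by field.
Qed.

End cot.

(** Uniform continuity bounds the path near [t] by [|c t| + 1], and bounds on adjacent intervals
    combine, so [cousin_additive] applies. *)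
Lemma abs_continuous_bounded (R : realType) (n m : nat)
    (c : R -> 'rV[R]_(2 * n + m)) (a b : R) : a <= b ->
  abs_continuous_on a b c ->
  exists2 B : R, 0 <= B & forall t, a <= t -> t <= b -> enorm (c t) <= B.
Proof.
move=> ab ac; have [d d0 acd] := abs_continuous_uniform ac ltr01.
apply: (@cousin_additive R a b (fun a b => exists2 B : R, 0 <= B &
  forall t, a <= t -> t <= b -> enorm (c t) <= B)) => //.
  move=> x y z _ xy yz _ [B1 B10 h1] [B2 B20 h2]; exists (B1 + B2).
    exact: addr_ge0.
  move=> t xt tz; have [ty|/ltW yt] := leP t y.
    by rewrite (le_trans (h1 t xt ty))// lerDl.
  by rewrite (le_trans (h2 t yt tz))// lerDr.
move=> t at_ tb; exists d => // x y ax xt ty yb xd yd.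
exists (enorm (c t) + 1); first by rewrite addr_ge0// enorm_ge0.
move=> s xs sy; have [st|/ltW ts] := leP s t.
  rewrite -[X in enorm X](subrK (c t)) addrC (le_trans (enormD_le _ _))// lerD2l.
  rewrite -opprB /enorm -scaleN1r edotZl edotZr mulrA mulN1r opprK mul1r ltW//.
  by apply: acd => //; [exact: le_trans xs|lra].
rewrite -[X in enorm X](subrK (c t)) addrC (le_trans (enormD_le _ _))// lerD2l ltW//.
by apply: acd => //; [exact: le_trans yb|lra].
Qed.

(** * The Hamilton-Jacobi function along a horizontal curve *)

Section lower_bound.
Variables (R : realType) (n m : nat).
Local Notation G := 'rV[R]_(2 * n + m).
Variable br : {bilinear G -> G -> G}.
Hypothesis Hbr : htype_group br.
Implicit Types c : R -> G.

(* The left side is the speed of [k <u, z> + y |x|^2 - L / 2] along a horizontal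
   curve with velocity [a], when [y' = - 2 y^2 - k^2 / 8] and [L' = |a|]; it is at
   most [- |a| (N - 1)^2 / 2], where [N] is the horizontal gradient of the first two
   terms. *)
Lemma speed_le0 (u : 'rV[R]_m) (x a : 'rV[R]_(2 * n)) (k y : R) : edot u u = 1 ->
  k * (2^-1 * edot u (hbr br x a)) +
  ((- 2 * y ^+ 2 - k ^+ 2 / 8) * enorm a * edot x x + y * (2 * edot a x)) -
  2^-1 * enorm a <= 0.
Proof.
move=> u1; pose w := (k / 2) *: Jop br u x + (2 * y) *: x.
have ww : edot w w = (k ^+ 2 / 4 + 4 * y ^+ 2) * edot x x.
  rewrite /w !(edotDl, edotDr) !(edotZl, edotZr) (edotC x) edot_Jop_self//.
  by rewrite Jop_isometry//; field.
have wa : edot w a = k * (2^-1 * edot u (hbr br x a)) + y * (2 * edot a x).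
  by rewrite /w edotDl !edotZl edot_Jop// (edotC x); field.
have := edot_le_enorm w a; rewrite wa.
have := enorm_sqr w; rewrite ww => N2.
have a0 := enorm_ge0 a; have := mulr_ge0 a0 (sqr_ge0 (enorm w - 1)).
have -> : (- 2 * y ^+ 2 - k ^+ 2 / 8) * enorm a * edot x x =
  - 2^-1 * enorm a * enorm w ^+ 2 by rewrite N2; field.
have -> : enorm a * (enorm w - 1) ^+ 2 =
  enorm a * enorm w ^+ 2 - 2 * (enorm w * enorm a) + enorm a by ring.
lra.
Qed.

Lemma length_lower_bound_eps c x z (l e theta : R) : (0 < m)%N ->
  horizontal br c -> c 0 = 0 -> c 1 = row_mx x z ->
  (path_length br c <= l%:E)%E -> 0 <= l -> 0 < e -> 0 < theta < pi ->
  4 * theta * enorm z + theta * (cos theta / sin theta) * edot x x <= l * (l + e).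
Proof.
move=> m0 hc c0 c1 cl l0 e0 /andP[t0 tpi].
have [ac _] := hc.
have [L [L0 Lmono L1 aeL]] := arclength Hbr hc (le_lt_trans cl (ltry _)).
have {}L1 : L 1 <= l by rewrite -lee_fin; exact: le_trans cl.
have [u [u1 zu]] := exists_direction z m0.
have uz : edot u z = enorm z by rewrite {1}zu edotZr u1 mulr1.
(* [T] bounds the time [e + L] along the whole curve, and [k] is chosen so that the cotangent is
   taken at [theta] at time [T]. *)
pose T := l + e; have T0 : 0 < T by rewrite ltr_wpDl.
pose k := 2 * theta / T; have k0 : 0 < k by rewrite divr_gt0// mulr_gt0.
have kT : k / 2 * T = theta by rewrite /k; field; rewrite gt_eqF.
have kTpi : k / 2 * T < pi by rewrite kT.
have [B B0 cB] := abs_continuous_bounded ler01 ac.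
pose al s := riccati k (e + L s).
pose X s := lsubmx (c s); pose Z s := rsubmx (c s).
pose H s := k * edot u (Z s) + al s * edot (X s) (X s) - 2^-1 * L s.
pose M := `|riccati k T| + `|riccati k e|.
have LT s : s <= 1 -> e + L s <= T.
  by move=> s1; rewrite /T addrC lerD2r (le_trans _ L1)// Lmono.
have eL s : e <= e + L s by rewrite lerDl.
have alle s t : s <= t -> t <= 1 -> al t <= al s.
  move=> st t1; apply: (riccati_le k0 e0 kTpi (eL s)); last exact: LT.
  by rewrite lerD2l Lmono.
have alT s : s <= 1 -> riccati k T <= al s.
  by move=> s1; exact: (riccati_le k0 e0 kTpi (eL s) (LT _ s1) (lexx T)).
have alM s : s <= 1 -> `|al s| <= M.
  move=> s1; have h1 := alT s s1.
  have h2 : al s <= riccati k e.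
    exact: (riccati_le k0 e0 kTpi (lexx e) (eL s) (LT _ s1)).
  have := ler_norm (riccati k e); have := ler_norm (- riccati k T).
  rewrite normrN /M ler_norml; have := normr_ge0 (riccati k T).
  by have := normr_ge0 (riccati k e); lra.
have M0 : 0 <= M by rewrite addr_ge0.
have HK s t : 0 <= s -> s <= t -> t <= 1 ->
    H t - H s <= (k + M * (2 * B)) * enorm (c t - c s).
  move=> s0 st t1; have s1 := le_trans st t1; have t00 := le_trans s0 st.
  set D := enorm (c t - c s).
  have hz : edot u (Z t) - edot u (Z s) <= D.
    have -> : edot u (Z t) - edot u (Z s) = edot u (rsubmx (c t - c s)).
      by rewrite linearB edotBr.
    apply: le_trans (edot_le_enorm _ _) _; rewrite {1}/enorm u1 sqrtr1 mul1r.
    exact: enorm_rsubmx_le.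
  have hx : `|edot (X t) (X t) - edot (X s) (X s)| <= 2 * B * D.
    have -> : edot (X t) (X t) - edot (X s) (X s) =
        edot (lsubmx (c t - c s)) (X t) + edot (lsubmx (c t - c s)) (X s).
      rewrite linearB !edotBl -/(X t) -/(X s) (edotC (X s) (X t)).
      by ring.
    have bnd r : 0 <= r -> r <= 1 -> `|edot (lsubmx (c t - c s)) (X r)| <= B * D.
      move=> r0 r1; apply: le_trans (norm_edot_le _ _) _; rewrite mulrC.
      apply: ler_pM; rewrite ?enorm_ge0//; last exact: enorm_lsubmx_le.
      exact: le_trans (enorm_lsubmx_le _) (cB _ r0 r1).
    rewrite (le_trans (ler_normD _ _))//.
    by have := bnd t t00 t1; have := bnd s s0 s1; lra.
  have hxa : al t * (edot (X t) (X t) - edot (X s) (X s)) <= M * (2 * B * D).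
    rewrite (le_trans (ler_norm _))// normrM ler_pM//; exact: alM.
  have hal : (al t - al s) * edot (X s) (X s) <= 0.
    by rewrite mulr_le0_ge0 ?edot_ge0// subr_le0 alle.
  have hL : L s <= L t := Lmono _ _ st.
  have hk : k * (edot u (Z t) - edot u (Z s)) <= k * D by rewrite ler_pM2l.
  rewrite /H mulrDl; move: hxa hal hk hL.
  move: (al t) (al s) (edot (X t) (X t)) (edot (X s) (X s)) (edot u _) (edot u _).
  by move=> at_ as_ p q r r'; lra.
have aeH : {ae @lebesgue_measure R, forall t, `[0, 1]%classic t ->
     derivable H t 1 /\ derive1 H t <= 0}.
  apply: (@filterS _ _ (ae_filter_ringOfSetsType lebesgue_measure)) aeL.
  move=> t + t01 => /(_ t01) [a [dc cE dL LE]].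
  move: t01; rewrite /= in_itv /= => /andP[t00 t1].
  have DL : is_derive t 1 L (enorm a) by rewrite -LE derive1E; exact: DeriveDef.
  have DX i : is_derive t 1 (fun s => X s 0 i) (a 0 i).
    have := is_derive_coord (lshift m i) dc; rewrite cE row_mxEl.
    by congr is_derive; apply/funext => s; rewrite mxE.
  have DZ i : is_derive t 1 (fun s => Z s 0 i) ((2^-1 *: hbr br (X t) a) 0 i).
    have := is_derive_coord (rshift (2 * n) i) dc; rewrite cE row_mxEr.
    by congr is_derive; apply/funext => s; rewrite mxE.
  have Du i : is_derive t 1 (fun s : R => u 0 i) ((0 : 'rV[R]_m) 0 i).
    by rewrite mxE; exact: is_derive_cst.
  have Dal : is_derive t 1 al ((- 2 * al t ^+ 2 - k ^+ 2 / 8) * (0 + enorm a)).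
    apply: is_derive1_comp (is_derive1D (is_derive_cst e t 1) DL).
    apply: is_derive_riccati => //; first exact: lt_le_trans (eL t).
    by apply: le_lt_trans kTpi; apply: ler_wpM2l (LT t t1); rewrite ltW// divr_gt0.
  have DH : is_derive t 1 H _ := is_derive1B (is_derive1D
    (is_derive1_scale k (is_derive_edot Du DZ))
    (is_derive1M Dal (is_derive_edot DX DX)))
    (is_derive1_scale 2^-1 DL).
  have [dH ->] := is_derive_derivable1 DH; split=> //.
  have := speed_le0 (X t) a k (al t) u1.
  rewrite edot0l add0r edotZr add0r (edotC (X t) a).
  by rewrite (_ : edot a (X t) + edot a (X t) = 2 * edot a (X t)) //; ring.
have kB : 0 <= k + M * (2 * B) by rewrite addr_ge0 ?(ltW k0)// !mulr_ge0.
have H10 := abs_continuous_nonincreasing ler01 kB ac HK aeH.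
(* The curve starts at the origin, so only [- L 0 / 2] is left. *)
have H0 : H 0 <= 0.
  rewrite /H /X /Z c0.
  have -> : lsubmx (0 : G) = 0 by apply/matrixP => ? ?; rewrite !mxE.
  have -> : rsubmx (0 : G) = 0 by apply/matrixP => ? ?; rewrite !mxE.
  by rewrite !edot0r !mulr0 add0r sub0r oppr_le0 mulr_ge0// invr_ge0.
have := le_trans H10 H0.
rewrite /H /X /Z c1 row_mxKl row_mxKr uz subr_le0 => h1.
(* The final time [e + L 1] may be less than [T]; since [riccati] decreases, replacing it by [T] is
   harmless. *)
have h2 : riccati k T * edot x x <= al 1 * edot x x.
  by rewrite ler_wpM2r ?edot_ge0// alT.
have h3 : k * enorm z + riccati k T * edot x x <= 2^-1 * l by move: L1; lra.
move: h3; rewrite /riccati kT -/T => h3.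
have T2 : 0 < 2 * T by rewrite mulr_gt0.
have := ler_wpM2l (ltW T2) h3.
have -> : 2 * T * (2^-1 * l) = l * T by field.
congr (_ <= _); rewrite /k; field.
by rewrite !gt_eqF// sin_gt0_pi// t0.
Qed.

Lemma length_lower_bound c x z (l theta : R) : (0 < m)%N ->
  horizontal br c -> c 0 = 0 -> c 1 = row_mx x z ->
  (path_length br c <= l%:E)%E -> 0 <= l -> 0 < theta < pi ->
  4 * theta * enorm z + theta * (cos theta / sin theta) * enorm x ^+ 2 <= l ^+ 2.
Proof.
move=> m0 hc c0 c1 cl l0 tI; rewrite enorm_sqr; apply/ler_addgt0Pr => e e0.
have l1 : 0 < l + 1 by rewrite ltr_wpDl.
(* With the shift [e / (l + 1)] the error [l e / (l + 1)] is at most [e], also for [l = 0]. *)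
apply: le_trans (length_lower_bound_eps m0 hc c0 c1 cl l0 (divr_gt0 e0 l1) tI) _.
rewrite mulrDr -expr2 lerD2l mulrA ler_pdivrMr// mulrC ler_pM2l// lerDl.
exact: ler01.
Qed.

Lemma cc_dist_ge x z (r : R) : (0 < m)%N ->
  (forall l : R, 0 <= l -> (forall theta, 0 < theta < pi ->
     4 * theta * enorm z + theta * (cos theta / sin theta) * enorm x ^+ 2 <= l ^+ 2) ->
     r <= l) ->
  (r%:E <= cc_dist br 0 (row_mx x z))%E.
Proof.
move=> m0 rl; apply: le_ereal_inf_tmp => _ [c [hc c0 c1] <-].
have p0 : (0 <= path_length br c)%E.
  by apply: integral_ge0 => t _; rewrite lee_fin; exact: enorm_ge0.
(* An infinite length bounds everything, and [-oo] is excluded by [p0]; only a finite length [l]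
   calls for the inequalities. *)
case E : (path_length br c) p0 => [l| |] //; rewrite ?leey// !lee_fin => l0.
apply: rl => // theta tI; apply: (length_lower_bound m0 hc c0 c1) => //.
by rewrite E.
Qed.

End lower_bound.

(** * Geodesics *)

(** The mean value theorem, with squares so that the estimates of several coordinates add up to one
    of a Euclidean norm. *)
Lemma lipschitz_is_derive (R : realType) (f df : R -> R) (M : R) :
  (forall t : R, is_derive t 1 f (df t)) -> (forall t, `|df t| <= M) ->
  forall s t, s <= t -> (f t - f s) ^+ 2 <= M ^+ 2 * (t - s) ^+ 2.
Proof.
move=> fdf dfM s t st.
have [x _ ->] := MVT_segment st (fun x _ => fdf x)
  (is_derive_within_continuous (fun x _ => fdf x)).
rewrite exprMn ler_wpM2r ?sqr_ge0// -real_normK ?num_real// ler_pXn2r ?nnegrE//.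
exact: le_trans (dfM x).
Qed.

Lemma abs_continuous_lipschitz (R : realType) (n m : nat)
    (c : R -> 'rV[R]_(2 * n + m)) (a b K : R) : 0 <= K ->
  (forall s t, a <= s -> s <= t -> t <= b -> enorm (c t - c s) <= K * (t - s)) ->
  abs_continuous_on a b c.
Proof.
move=> K0 cK e e0; have K1 : 0 < K + 1 by rewrite ltr_wpDl.
exists (e / (K + 1)); first exact: divr_gt0.
move=> k s t st _ std; apply: (@le_lt_trans _ _ (K * \sum_i (t i - s i))).
  rewrite mulr_sumr; apply: ler_sum => i _.
  by have [? [? ?]] := st i; exact: cK.
have S0 : 0 <= \sum_i (t i - s i).
  by apply: sumr_ge0 => i _; rewrite subr_ge0; have [_ []] := st i.
move: std; rewrite ltr_pdivlMr// => /(le_lt_trans _); apply.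
by rewrite mulrC ler_wpM2l// lerDl.
Qed.

Section upper_bound.
Variables (R : realType) (n m : nat).
Local Notation G := 'rV[R]_(2 * n + m).
Variable br : {bilinear G -> G -> G}.
Hypothesis Hbr : htype_group br.

(** Since [[v, J_u v] = |v|^2 u], the condition on [dC] says that the central coordinate is driven
    by the signed area swept in the plane of [v] and [J_u v]. These vectors are orthogonal of equal
    norm, so [dA^2 + dB^2 = 1] makes the speed constantly [|v|]. *)
Lemma horizontal_curve (u : 'rV[R]_m) (v : 'rV[R]_(2 * n))
    (A B C dA dB dC : R -> R) (M : R) :
  edot u u = 1 ->
  (forall t : R, is_derive t 1 A (dA t)) -> (forall t : R, is_derive t 1 B (dB t)) ->
  (forall t : R, is_derive t 1 C (dC t)) ->
  (forall t, dA t ^+ 2 + dB t ^+ 2 = 1) ->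
  (forall t, dC t = 2^-1 * ((A t * dB t - B t * dA t) * edot v v)) ->
  (forall t, `|dC t| <= M) ->
  let c t := row_mx (A t *: v + B t *: Jop br u v) (C t *: u) in
  horizontal br c /\ path_length br c = (enorm v)%:E.
Proof.
move=> u1 hA hB hC AB1 dCE dCM c.
set w := Jop br u v.
have vw : edot v w = 0 by rewrite edotC edot_Jop_self.
have ww : edot w w = edot v v by exact: Jop_isometry.
have M0 : 0 <= M by rewrite (le_trans _ (dCM 0)).
pose a t := dA t *: v + dB t *: w.
have Dc t : derivable c t 1 /\ derive1 c t = row_mx (a t) (dC t *: u).
  have coord j : is_derive t 1 (fun s => c s 0 j) ((row_mx (a t) (dC t *: u)) 0 j).
    case: (split_ordP j) => i ->.
      have -> : (fun s => c s 0 (lshift m i)) = (fun s => v 0 i * A s + w 0 i * B s).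
        by apply/funext => s; rewrite row_mxEl !mxE; ring.
      rewrite row_mxEl !mxE [dA t * _]mulrC [dB t * _]mulrC.
      by apply: is_derive1D; exact: is_derive1_scale.
    have -> : (fun s => c s 0 (rshift (2 * n) i)) = (fun s => u 0 i * C s).
      by apply/funext => s; rewrite row_mxEr !mxE; ring.
    by rewrite row_mxEr !mxE [dC t * _]mulrC; exact: is_derive1_scale.
  have dc : derivable c t 1.
    by apply/derivable_mxP => i j; rewrite ord1; have [] := coord j.
  split=> //; rewrite derive1E derive_mx//; apply/matrixP => i j.
  by rewrite mxE ord1; have [] := coord j.
have cX t : derive1 c t = \sum_i a t 0 i *: Xfield br i (c t).
  rewrite (Dc t).2 sum_Xfield//; congr row_mx.
  have hvw : hbr br v w = edot v v *: u by exact: hbr_Jop.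
  have hwv : hbr br w v = (- edot v v) *: u by rewrite hbrC// hvw scaleNr.
  rewrite /a hbrDl !hbrDr !hbrZl !hbrZr !hbrxx// hvw hwv !scaler0 add0r addr0.
  by rewrite dCE !scalerA -scalerDl scalerA; congr (_ *: _); ring.
have span t : linear_span [set Xfield br i (c t) | i in setT] (derive1 c t).
  exists (2 * n)%N, (fun i => a t 0 i), (fun i => Xfield br i (c t)).
  by split=> [i|]; [exists i|exact: cX].
split; last first.
  have na t : enorm (hcoord br c t) = enorm v.
    rewrite (hcoord_lsubmx Hbr (span t)) (Dc t).2 row_mxKl /enorm; congr Num.sqrt.
    rewrite /a !(edotDl, edotDr) !(edotZl, edotZr) ww (edotC w v) vw.
    by rewrite !mulr0 addr0 add0r !mulrA -mulrDl -!expr2 AB1 mul1r.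
  rewrite /path_length; under eq_integral do rewrite na.
  have I01 : lebesgue_measure (`[0%R, 1%R]%classic : set R) = 1%E.
    by rewrite lebesgue_measure_itv /= lte_fin ltr01 sube0.
  by rewrite integral_cst// [X in (_ * X)%E]I01 mule1.
split; last first.
  exists set0; split; [exact: measurable0|exact: measure0|move=> t /=; apply=> _].
  by split; [exact: (Dc t).1|exact: span].
(* The squared Lipschitz constant: [|v|^2] for each of [A] and [B], whose derivatives are at most 1
   in absolute value, and [M^2] for [C]. *)
have K0 : 0 <= 2 * edot v v + M ^+ 2 by rewrite addr_ge0 ?sqr_ge0// mulr_ge0// edot_ge0.
apply: (@abs_continuous_lipschitz _ _ _ _ _ _ (Num.sqrt (2 * edot v v + M ^+ 2))).
  exact: sqrtr_ge0.
move=> s t _ st _.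
have ts : 0 <= t - s by rewrite subr_ge0.
rewrite -(@ler_pXn2r _ 2)// ?nnegrE ?enorm_ge0 ?mulr_ge0 ?sqrtr_ge0//.
rewrite enorm_sqr exprMn sqr_sqrtr//.
have le1 (x y : R) : x ^+ 2 + y ^+ 2 = 1 -> `|x| <= 1.
  move=> xy; rewrite -(@ler_pXn2r _ 2)// ?nnegrE// real_normK ?num_real// expr1n -xy.
  by rewrite lerDl sqr_ge0.
have LA := lipschitz_is_derive hA (fun r => le1 _ _ (AB1 r)) st.
have LB := lipschitz_is_derive hB (fun r => le1 _ _ (etrans (addrC _ _) (AB1 r))) st.
have LC := lipschitz_is_derive hC dCM st.
have -> : c t - c s = row_mx ((A t - A s) *: v + (B t - B s) *: w) ((C t - C s) *: u).
  rewrite /c opp_row_mx add_row_mx !scalerBl; congr row_mx.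
  by rewrite opprD addrACA.
rewrite edot_row_mx !(edotDl, edotDr) !(edotZl, edotZr) ww (edotC w v) vw u1.
rewrite !expr1n !mul1r in LA LB.
have := ler_wpM2r (edot_ge0 v) LA; have := ler_wpM2r (edot_ge0 v) LB.
move: LC; move: (A t - A s) (B t - B s) (C t - C s) => x y z; move: (t - s) => r.
by lra.
Qed.

End upper_bound.

Section geodesics.
Variables (R : realType) (n m : nat).
Local Notation G := 'rV[R]_(2 * n + m).
Variable br : {bilinear G -> G -> G}.
Hypothesis Hbr : htype_group br.
Implicit Types (x v : 'rV[R]_(2 * n)) (z u : 'rV[R]_m).

Lemma cc_dist_le c p q (r : R) : horizontal br c -> c 0 = p -> c 1 = q ->
  path_length br c = r%:E -> (cc_dist br p q <= r%:E)%E.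
Proof. by move=> hc c0 c1 <-; apply: ereal_inf_lbound; exists c. Qed.

Lemma cc_dist_line_le u x : edot u u = 1 ->
  (cc_dist br 0 (row_mx x 0) <= (enorm x)%:E)%E.
Proof.
move=> u1.
have hA (t : R) : is_derive t 1 (fun t : R => t) 1 := is_derive_id t 1.
have hB (t : R) : is_derive t 1 (fun _ : R => 0 : R) 0 := is_derive_cst 0 t 1.
have [||//|hc lc] := @horizontal_curve R n m br Hbr u x _ _ _ (fun=> 1) (fun=> 0) (fun=> 0)
  0 u1 hA hB hB.
- by move=> t; rewrite expr1n expr0n addr0.
- by move=> t; rewrite mul0r mulr0 subrr mul0r mulr0.
- by move=> t; rewrite normr0.
apply: cc_dist_le hc _ _ lc; first by rewrite !scale0r addr0 row_mx0.
by rewrite !scale0r addr0 scale1r.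
Qed.

(** The curve is a circular arc traversed at angular rate [w = 2 theta], with [A' = cos (w t)] and
    [B' = sin (w t)]; double angle formulas give the endpoint at [t = 1]. There
    [A B' - B A' = (1 - cos (w t)) / w], whence [C]. *)
Lemma cc_dist_arc_le u v (theta : R) : edot u u = 1 -> 0 < theta ->
  (cc_dist br 0 (row_mx
     ((sin theta / theta) *: (cos theta *: v + sin theta *: Jop br u v))
     ((enorm v ^+ 2 / (4 * theta ^+ 2) * (theta - sin theta * cos theta)) *: u)) <=
   (enorm v)%:E)%E.
Proof.
move=> u1 t0; have tn0 : theta != 0 by rewrite gt_eqF.
pose w := 2 * theta; have w0 : 0 < w by rewrite mulr_gt0.
have wn0 : w != 0 by rewrite gt_eqF.
pose A t := w^-1 * sin (w * t).
pose B t := w^-1 * (1 - cos (w * t)).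
pose C t := edot v v / (2 * w) * (t - A t).
pose dA t := cos (w * t).
pose dB t := sin (w * t).
pose dC t := edot v v / (2 * w) * (1 - cos (w * t)).
have Dl (t : R) : is_derive t 1 (fun t => w * t) (w * 1) :=
  is_derive1_scale w (is_derive_id t 1).
have hA (t : R) : is_derive t 1 A (dA t).
  have D : is_derive t 1 A _ :=
    is_derive1_scale w^-1 (is_derive1_comp (is_derive_sin (w * t)) (Dl t)).
  by apply: is_derive_eq D _; rewrite /dA; field.
have hB (t : R) : is_derive t 1 B (dB t).
  have D : is_derive t 1 B _ := is_derive1_scale w^-1
    (is_derive1B (is_derive_cst (1 : R) t 1)
       (is_derive1_comp (is_derive_cos (w * t)) (Dl t))).
  by apply: is_derive_eq D _; rewrite /dB; field.
have hC (t : R) : is_derive t 1 C (dC t).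
  exact: (is_derive1_scale (edot v v / (2 * w)) (is_derive1B (is_derive_id t 1) (hA t))).
have AB1 t : dA t ^+ 2 + dB t ^+ 2 = 1 by exact: cos2Dsin2.
have dCE t : dC t = 2^-1 * ((A t * dB t - B t * dA t) * edot v v).
  rewrite /dC /A /B /dA /dB; have := cos2Dsin2 (w * t).
  move: (sin _) (cos _) => S c' /(canRL (addKr _)) S2.
  have -> : 2^-1 * ((w^-1 * S * S - w^-1 * (1 - c') * c') * edot v v) =
      edot v v / (2 * w) * (S ^+ 2 - (1 - c') * c') by field.
  by rewrite S2; field.
have k0 : 0 <= edot v v / (2 * w) by rewrite divr_ge0 ?edot_ge0// ltW// mulr_gt0.
have dCM t : `|dC t| <= edot v v / (2 * w) * 2.
  rewrite /dC normrM (ger0_norm k0) ler_wpM2l// ler_norml.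
  by have := cos_le1 (w * t); have := cos_geN1 (w * t); lra.
have [hc lc] := horizontal_curve Hbr u1 hA hB hC AB1 dCE dCM.
apply: cc_dist_le hc _ _ lc.
  by rewrite /C /B /A !mulr0 sin0 cos0 subrr !mulr0 subrr mulr0 !scale0r addr0 row_mx0.
rewrite /C /A /B !mulr1 /w sin2E cos2E enorm_sqr; congr row_mx.
  by rewrite scalerDr !scalerA; congr (_ *: _ + _ *: _); field.
by congr (_ *: _); field.
Qed.

Lemma cc_dist_arc x z (theta : R) : (0 < m)%N -> 0 < theta < pi ->
  4 * enorm z * sin theta ^+ 2 = enorm x ^+ 2 * (theta - sin theta * cos theta) ->
  cc_dist br 0 (row_mx x z) = (enorm x * (theta / sin theta))%:E.
Proof.
move=> m0 tI zE; have /andP[t0 tpi] := tI; have s0 := sin_gt0_pi tI.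
have tn0 : theta != 0 by rewrite gt_eqF.
have sn0 : sin theta != 0 by rewrite gt_eqF.
have k0 : 0 <= theta / sin theta by rewrite divr_ge0// ltW.
apply/eqP; rewrite eq_le; apply/andP; split.
  have [u [u1 zu]] := exists_direction z m0.
  (* The inverse image of [x] under the endpoint map [(sin theta / theta) (cos theta + sin theta
     J_u)], computed as for complex numbers since [J_u^2 = -1]. *)
  pose v := (theta / sin theta) *: (cos theta *: x - sin theta *: Jop br u x).
  have vn : edot v v = (theta / sin theta) ^+ 2 * edot x x.
    rewrite /v edotZl edotZr !(edotBl, edotBr) !(edotZl, edotZr).
    rewrite (edotC x (Jop br u x)) edot_Jop_self// Jop_isometry//.
    rewrite -[in RHS](mul1r (edot x x)) -(cos2Dsin2 theta).
    by ring.
  have vE : enorm v = enorm x * (theta / sin theta).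
    by rewrite {1}/enorm vn mulrC sqrtrM ?edot_ge0// sqrtr_sqr ger0_norm.
  have zv : (enorm v ^+ 2 / (4 * theta ^+ 2) * (theta - sin theta * cos theta)) *: u = z.
    rewrite [RHS]zu vE; congr (_ *: _).
    have -> : enorm z = (4 * enorm z * sin theta ^+ 2) / (4 * sin theta ^+ 2) by field.
    by rewrite zE; field; rewrite ?tn0 ?sn0.
  have xv : (sin theta / theta) *: (cos theta *: v + sin theta *: Jop br u v) = x.
    rewrite /v JopZr// -scaleNr JopDr// !JopZr// JopK//.
    apply/edot_ext => y; rewrite !(edotZl, edotDl, edotNl).
    rewrite -[RHS]mul1r -(cos2Dsin2 theta).
    by field; rewrite ?tn0 ?sn0.
  by have := cc_dist_arc_le v u1 t0; rewrite xv zv vE.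
apply: cc_dist_ge => // l l0 /(_ theta tI) h.
have r0 : 0 <= enorm x * (theta / sin theta) by rewrite mulr_ge0 ?enorm_ge0.
rewrite -(@ler_pXn2r _ 2)// ?nnegrE//; apply: le_trans h.
(* Substituting [zE], the terms in [theta cot theta |x|^2] cancel and the lower bound at this
   [theta] becomes [(|x| theta / sin theta)^2]. *)
have -> : 4 * theta * enorm z = theta / sin theta ^+ 2 * (4 * enorm z * sin theta ^+ 2).
  by field.
by rewrite zE le_eqVlt; apply/orP; left; apply/eqP; field.
Qed.

End geodesics.

(** * The cases z = 0 and x = 0 *)

Section limit_cases.
Variables (R : realType) (n m : nat).
Local Notation G := 'rV[R]_(2 * n + m).
Variable br : {bilinear G -> G -> G}.
Hypothesis Hbr : htype_group br.
Implicit Types (x : 'rV[R]_(2 * n)) (z : 'rV[R]_m).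

(** The chain [t cot t >= cos t >= cos^2 t = 1 - sin^2 t >= 1 - t^2]; it quantifies the limit of
    [t cot t] at 0. *)
Lemma one_sub_sqr_le_cot (t : R) : 0 < t -> t <= 1 -> 1 - t ^+ 2 <= t * (cos t / sin t).
Proof.
move=> t0 t1; have pi2 := pi_ge2 R.
have s0 : 0 < sin t by rewrite sin_gt0_pi// t0; lra.
have c0 : 0 <= cos t.
  by apply: cos_ge0_pihalf; have := pihalf_ge1 R; lra.
have st : sin t <= t.
  have [c _] := MVT_segment (ltW t0) (fun s _ => is_derive_sin s)
    (is_derive_within_continuous (fun s _ => is_derive_sin s)).
  rewrite sin0 !subr0 => ->.
  by rewrite -[leRHS]mul1r ler_wpM2r ?cos_le1// ltW.
have ct : cos t <= t * (cos t / sin t).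
  by rewrite mulrCA ler_peMr// ler_pdivlMr// mul1r.
apply: le_trans ct.
have c2 : cos t ^+ 2 <= cos t by rewrite expr2 ler_piMr// cos_le1.
have s2 : sin t ^+ 2 <= t ^+ 2 by rewrite ler_pXn2r ?nnegrE// ltW.
by have := cos2Dsin2 t; lra.
Qed.

Lemma cc_dist_horizontal x : (0 < m)%N -> cc_dist br 0 (row_mx x 0) = (enorm x)%:E.
Proof.
move=> m0; apply/eqP; rewrite eq_le; apply/andP; split.
  have [u [u1 _]] := exists_direction (0 : 'rV[R]_m) m0.
  exact: cc_dist_line_le u1.
apply: cc_dist_ge => // l l0 h.
rewrite -(@ler_pXn2r _ 2)// ?nnegrE ?enorm_ge0//; apply/ler_addgt0Pr => e e0.
have x1 : 0 < enorm x ^+ 2 + 1 by rewrite ltr_wpDl// sqr_ge0.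
(* Chosen so that the loss [|x|^2 t^2 <= |x|^2 t] is at most [e]. *)
pose t := Num.min 1 (e / (enorm x ^+ 2 + 1)).
have t0 : 0 < t by rewrite lt_min ltr01 divr_gt0.
have t1 : t <= 1 by rewrite ge_min lexx.
have te : enorm x ^+ 2 * t <= e.
  have : t <= e / (enorm x ^+ 2 + 1) by rewrite ge_min lexx orbT.
  by rewrite ler_pdivlMr// => te; have := ltW t0; lra.
have tI : 0 < t < pi by rewrite t0; have := pi_ge2 R; lra.
have := h t tI; rewrite enorm0 mulr0 add0r.
have := ler_wpM2r (sqr_ge0 (enorm x)) (one_sub_sqr_le_cot t0 t1).
have : enorm x ^+ 2 * t ^+ 2 <= enorm x ^+ 2 * t.
  by rewrite ler_wpM2l ?sqr_ge0// expr2 ler_piMr// ltW.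
by lra.
Qed.

Lemma cc_dist_vertical z : (0 < n)%N -> (0 < m)%N ->
  cc_dist br 0 (row_mx 0 z) = (Num.sqrt (4 * pi * enorm z))%:E.
Proof.
move=> n0 m0; have pi0 := pi_gt0 R; have pin0 : pi != 0 :> R by rewrite gt_eqF.
have k0 : 0 <= 4 * pi * enorm z by rewrite mulr_ge0 ?enorm_ge0// mulr_ge0// ltW.
apply/eqP; rewrite eq_le; apply/andP; split.
  have [u [u1 zu]] := exists_direction z m0.
  have n20 : (0 < 2 * n)%N by rewrite muln_gt0.
  (* At [theta = pi] the arc is a full circle, closed whatever the direction of [v]; its norm is
     fixed by the height [|v|^2 / (4 pi) = |z|]. *)
  pose v : 'rV[R]_(2 * n) := Num.sqrt (4 * pi * enorm z) *: delta_mx 0 (Ordinal n20).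
  have vE : enorm v = Num.sqrt (4 * pi * enorm z).
    by rewrite /v enormZ ?sqrtr_ge0// {2}/enorm edot_delta mxE !eqxx sqrtr1 mulr1.
  have := cc_dist_arc_le Hbr v u1 pi0.
  rewrite sinpi !mul0r scale0r subr0 vE sqr_sqrtr//.
  suff -> : (4 * pi * enorm z / (4 * pi ^+ 2) * pi) *: u = z by [].
  rewrite [RHS]zu; congr (_ *: _); move: pi pin0 => p p0.
  by field; rewrite ?p0.
apply: cc_dist_ge => // l l0 h.
rewrite -(@ler_pXn2r _ 2)// ?nnegrE ?sqrtr_ge0// sqr_sqrtr//.
apply/ler_addgt0Pr => e e0.
have z1 : 0 < 4 * enorm z + 1 by rewrite ltr_wpDl// mulr_ge0// enorm_ge0.
(* Evaluating at [theta = pi - t] loses [4 t |z|], which this choice keeps below [e]. *)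
pose t := Num.min 1 (e / (4 * enorm z + 1)).
have t0 : 0 < t by rewrite lt_min ltr01 divr_gt0.
have t1 : t <= 1 by rewrite ge_min lexx.
have te : 4 * enorm z * t <= e.
  have : t <= e / (4 * enorm z + 1) by rewrite ge_min lexx orbT.
  by rewrite ler_pdivlMr// => te; have := ltW t0; lra.
have tI : 0 < pi - t < pi by have := pi_ge2 R; lra.
have := h _ tI; rewrite enorm0 expr0n mulr0 addr0.
by lra.
Qed.

End limit_cases.

Unset Implicit Arguments.

Theorem mainTheorem6 (R : realType) (n m : nat) (n_gt0 : (0 < n)%N)
    (m_gt0 : (0 < m)%N)
    (br : {bilinear 'rV[R]_(2 * n + m) -> 'rV[R]_(2 * n + m) ->
                    'rV[R]_(2 * n + m)})
    (Hbr : htype_group br) (x : 'rV[R]_(2 * n)) (z : 'rV[R]_m) :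
  [/\ z != 0 -> x != 0 ->
        exists theta : R,
          unique (fun t : R => 0 <= t < pi /\
                               nu t = 4 * enorm z / enorm x ^+ 2) theta /\
          cc_dist br 0 (row_mx x z) = (enorm x * (theta / sin theta))%:E,
      z = 0 -> cc_dist br 0 (row_mx x z) = (enorm x)%:E &
      x = 0 -> cc_dist br 0 (row_mx x z) = (Num.sqrt (4 * pi * enorm z))%:E].
Proof.
split=> [z0 x0|->|->]; last 2 first.
- exact: cc_dist_horizontal.
- exact: cc_dist_vertical.
have pz := enorm_gt0 z0; have px := enorm_gt0 x0.
have y0 : 0 < 4 * enorm z / enorm x ^+ 2 by rewrite divr_gt0 ?mulr_gt0 ?exprn_gt0.
have [theta tI uniq_theta] := nu_unique_root y0.
exists theta; split=> //; apply: (cc_dist_arc Hbr m_gt0 tI).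
have [[_ nuth] _] := uniq_theta; have /andP[t0 _] := tI; have s0 := sin_gt0_pi tI.
(* Cleared of denominators, the equation for [nu] is the relation between [x], [z] and [theta]
   required by [cc_dist_arc]. *)
rewrite nuE ?gt_eqF// in nuth.
have : (theta - sin theta * cos theta) =
    4 * enorm z / enorm x ^+ 2 * sin theta ^+ 2.
  by rewrite -nuth divfK// expf_neq0// gt_eqF.
by move=> ->; field; rewrite gt_eqF.
Qed.
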